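(* Let $\ell\in\mathbb{N}$, $n\ge 2\ell$, let $K$ be a probability measure on a measurable space $(\mathbb{X},\mathcal{X})$, let $h:\mathbb{X}^\ell\to\{0,1\}$ be measurable and symmetric, and let $\beta_n$ be a binomial point process of $n$ independent points with distribution $K$. Let $$ S=\frac1{\ell!}\sum_{(x_1,\dots,x_\ell)\in\beta_{n,\neq}^\ell}h(x_1,\dots,x_\ell),\qquad \tilde S=\frac1{\ell!}\sum_{(x_1,\dots,x_\ell)\in\beta_{n-2\ell,\neq}^\ell}h(x_1,\dots,x_\ell), $$ $$ \lambda=\mathbb{E}[S]=\frac{(n)_\ell}{\ell!}\int_{\mathbb{X}^\ell}h\,dK^\ell, $$ and $$ r=\max_{1\le i\le\ell-1}(n)_{2\ell-i}\int_{\mathbb{X}^i}\bigg(\int_{\mathbb{X}^{\ell-i}}h(x_1,\dots,x_\ell)\,dK^{\ell-i}(x_{i+1},\dots,x_\ell)\bigg)^2dK^i(x_1,\dots,x_i) $$ if $\ell\ge2$, and $r=0$ if $\ell=1$. Assume $\lambda>0$, and let $P_\lambda$ be a Poisson random variable with mean $\lambda$. Then $$ d_{TV}(S,P_\lambda)\le(1\wedge\lambda)\Big(\frac{2^\ell r}{\ell!\lambda}+\frac{2\ell^2\lambda}{n}\Big)\quad\text{and}\quad d_W(S,P_\lambda)\le(1.1437\sqrt\lambda\wedge\lambda)\Big(\frac{2^\ell r}{\ell!\lambda}+\frac{2\ell^2\lambda}{n}\Big). $$ Moreover, for all $m\in\mathbb{N}$, $$ \big|\mathbb{P}(S=0)-e^{-\lambda}\big|\le\Bigg[\sum_{k=0}^{m-1}\Big(\frac{\lambda}{k+1}\wedge\frac{k!}{\lambda^k}\Big)\mathbb{P}(\tilde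 S\le k)+\frac{m!}{\lambda^m}\Bigg]\Big(\frac{2^\ell r}{\ell!\lambda}+\frac{2\ell^2\lambda}{n}\Big), $$ and for all $v\in\mathbb{N}$, $$ |\mathbb{P}(S\le v)-\mathbb{P}(P_\lambda\le v)|\le\Big[\frac{(v+1)^2}{\lambda}+\mathbb{P}(\tilde S\le v)\Big]\Big(\frac{2^\ell r}{\ell!\lambda}+\frac{2\ell^2\lambda}{n}\Big). $$
   Context: $\mathbb{N}=\{1,2,\dots\}$, $a\wedge b=\min\{a,b\}$, and $(n)_j=n(n-1)\cdots(n-j+1)$ is the descending factorial. A binomial point process $\beta_n=\sum_{i=1}^n\delta_{X_i}$ consists of $n$ i.i.d. points $X_1,\dots,X_n$ with distribution $K$; $\beta_{n,\neq}^\ell$ is the collection of $\ell$-tuples of distinct points of $\beta_n$, i.e. of tuples $(X_{i_1},\dots,X_{i_\ell})$ with pairwise distinct indices. $\beta_{n-2\ell}$ is the analogous process with $n-2\ell$ points. For an $\mathbb{N}_0$-valued random variable $S$, $d_{TV}(S,P_\lambda)=\sup_{A\subset\mathbb{N}_0}|\mathbb{P}(S\in A)-\mathbb{P}(P_\lambda\in A)|$ and $d_W(S,P_\lambda)=\sup_g|\mathbb{E}[g(S)]-\mathbb{E}[g(P_\lambda)]|$, the supremum running over all $g:\mathbb{N}_0\to\mathbb{R}$ that are Lipschitz with constant at most $1$. *)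

(* Defs.v *)
From HB Require Import structures.
From mathcomp Require Import all_boot all_order all_algebra perm.
From mathcomp Require Import all_classical all_reals all_analysis.

Set Implicit Arguments.
Unset Strict Implicit.
Unset Printing Implicit Defensive.

Import Order.TTheory GRing.Theory Num.Theory.
Import numFieldNormedType.Exports.

Local Open Scope classical_set_scope.
Local Open Scope ring_scope.

Section power_measure.
Context {d} {T : measurableType d} {R : realType}.

Definition cons_pair k (x : T * k.-tuple T) : k.+1.-tuple T :=
  [tuple of x.1 :: x.2].

Lemma measurable_cons_pair k : measurable_fun setT (@cons_pair k).
Proof. exact: measurable_cons. Qed.

HB.instance Definition _ k := isMeasurableFun.Build _ _ _ _ (@cons_pair k)
  (measurable_cons_pair (k := k)).

(* The product measure K^k on k.-tuple T. It is built by transporting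
   K \x K^(k-1) along cons_pair; [power_prob_box] is its characterization. *)
Fixpoint power_prob (K : probability T R) (k : nat) :
    probability (k.-tuple T) R :=
  match k with
  | 0 => \d_([tuple])
  | k'.+1 => distribution (K \x power_prob K k')%E (@cons_pair k')
  end.

Lemma power_prob_box (K : probability T R) k (A : 'I_k -> set T) :
  (forall i, measurable (A i)) ->
  power_prob K k [set t | forall i, A i (tnth t i)] = (\prod_(i < k) K (A i))%E.
Proof.
elim: k A => [|k IH] A mA.
  by rewrite big_ord0 /= diracE mem_set //= => -[].
rewrite big_ord_recl -(IH (fun i => A (lift ord0 i))) //.
rewrite /= /distribution /pushforward.
set B := (X in (_ * power_prob K k X)%E).
have mB : measurable B.
  have -> : B = \bigcap_(i in [set: 'I_k])
      ((fun t : k.-tuple T => tnth t i) @^-1` A (lift ord0 i)).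
    by apply/seteqP; split => t Bt i *; exact: Bt.
  apply: fin_bigcap_measurable => // i _; rewrite -[X in measurable X]setTI.
  exact: measurable_tnth.
rewrite [X in product_measure1 _ _ X](_ : _ = A ord0 `*` B).
  by rewrite product_measure1E.
apply/seteqP; split => -[x t] /=.
  move=> H; split; first by have := H ord0; rewrite tnth0.
  by move=> i; have := H (lift ord0 i); rewrite tnthS.
move=> [Ax Bt] i; case: (unliftP ord0 i) => [j|] ->; last by rewrite tnth0.
by rewrite tnthS; exact: Bt.
Qed.

End power_measure.

Section binomial_process.
Context {d dO} {T : measurableType d} {O : measurableType dO} {R : realType}.

Definition mutually_independent (P : probability O R) n
    (X : 'I_n -> {RV P >-> T}) : Prop :=
  forall (J : {set 'I_n}) (A : 'I_n -> set T),
    (forall i, i \in J -> measurable (A i)) ->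
    P (\bigcap_(i in [set` J]) (X i @^-1` A i)) =
      (\prod_(i in J) P (X i @^-1` A i))%E.

(* The points of a binomial point process: n i.i.d. points with law K. *)
Definition binomial_points (P : probability O R) (K : probability T R) n
    (X : 'I_n -> {RV P >-> T}) : Prop :=
  (forall i A, measurable A -> distribution P (X i) A = K A) /\
  mutually_independent X.

End binomial_process.

Definition symmetric_kernel (T : Type) l (h : l.-tuple T -> bool) : Prop :=
  forall (s : 'S_l) (t : l.-tuple T), h [tuple tnth t (s i) | i < l] = h t.

(* Points are distinguished by their indices, so two equal points of the
   process count as distinct. The quotient is an exact one when h is symmetric,
   see [factM_ustat]. *)
Definition ustat (T O : Type) l (h : l.-tuple T -> bool) n
    (X : 'I_n -> O -> T) (w : O) : nat :=
  ((\sum_(s : {ffun 'I_l -> 'I_n} | injectiveb s)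
      h [tuple X (s i) w | i < l]) %/ l`!)%N.

Section ustat_exact.
Variables (T O : Type) (l : nat) (h : l.-tuple T -> bool).
Hypothesis hsym : symmetric_kernel h.

Lemma factM_ustat n (X : 'I_n -> O -> T) w :
  (l`! * ustat h X w = \sum_(s : {ffun 'I_l -> 'I_n} | injectiveb s)
                         h [tuple X (s i) w | i < l])%N.
Proof.
rewrite /ustat mulnC divnK //.
pose im (s : {ffun 'I_l -> 'I_n}) := [set s i | i : 'I_l]%SET.
rewrite (partition_big im (fun A => #|A| == l)) /=; last first.
  by move=> s /injectiveP injs; rewrite /im card_imset // card_ord.
apply: (big_ind (dvdn l`!)) => [|a b|A /eqP cA]; [exact: dvdn0 | exact: dvdn_add |].
have imA (s : {ffun 'I_l -> 'I_n}) : injectiveb s && (im s == A) =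
    (s \in [set f : {ffun 'I_l -> 'I_n} | f \in ffun_on (mem A) & injectiveb f]%SET).
  rewrite inE andbC; apply: andb_id2r => /injectiveP injs.
  apply/eqP/ffun_onP => [<- i | sA]; first exact: imset_f.
  apply/eqP; rewrite eqEcard card_imset // card_ord cA leqnn andbT.
  by apply/fintype.subsetP => _ /imsetP[i _ ->]; exact: sA.
rewrite (eq_bigl _ _ imA).
have [S0|[s0 s0A]] := set_0Vmem
  [set f : {ffun 'I_l -> 'I_n} | f \in ffun_on (mem A) & injectiveb f]%SET.
  by rewrite S0 big_set0 dvdn0.
rewrite (eq_bigr (fun=> h [tuple X (s0 i) w | i < l] : nat)); last first.
  move=> s; rewrite -imA => /andP[/injectiveP injs /eqP ims].
  move: s0A; rewrite -imA => /andP[/injectiveP injs0 /eqP ims0].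
  have ex i : exists j, s0 j == s i.
    have : s i \in im s0 by rewrite ims0 -ims imset_f.
    by case/imsetP => j _ ->; exists j.
  pose p i := xchoose (ex i).
  have pE i : s0 (p i) = s i by apply/eqP; exact: (xchooseP (ex i)).
  have injp : injective p by move=> i j /(congr1 s0); rewrite !pE => /injs.
  rewrite -(hsym (perm injp) [tuple X (s0 i) w | i < l]).
  congr (nat_of_bool (h _)); apply: eq_from_tnth => i.
  by rewrite !tnth_mktuple permE pE.
rewrite sum_nat_const card_inj_ffuns_on card_ord.
by rewrite (_ : #|mem A| = l) // ffactnn dvdn_mulr.
Qed.

End ustat_exact.

Section overlap.
Context {d} {T : measurableType d} {R : realType}.

(* The quantity r; every term of the maximum is nonnegative, so the default 0
   only matters for l <= 1. *)
Definition overlap (K : probability T R) l (h : l.-tuple T -> bool) (n : nat) : R :=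
  \big[Num.max/0]_(i < l | (0 < i)%N)
    ((n ^_ (2 * l - i))%:R *
     \int[power_prob K i]_x
       (\int[power_prob K (l - i)]_y
          (h (tcast (subnKC (ltnW (ltn_ord i))) [tuple of x ++ y]))%:R) ^+ 2).

End overlap.

Section distances.
Context {d1 d2} {T1 : measurableType d1} {T2 : measurableType d2} {R : realType}.
Variables (P : probability T1 R) (S : T1 -> nat).
Variables (Q : probability T2 R) (Z : T2 -> nat).
Local Open Scope ereal_scope.

Definition dTV : \bar R :=
  ereal_sup [set `|P (S @^-1` A) - Q (Z @^-1` A)| | A in [set: set nat]].

Definition lipschitz1 (g : nat -> R) : Prop :=
  forall a b : nat, (`|g a - g b| <= `|a%:R - b%:R|)%R.

Definition dW : \bar R :=
  ereal_sup [set `|'E_P[g \o S] - 'E_Q[g \o Z]| | g in lipschitz1].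

End distances.

Definition poisson_variable d (O : measurableType d) (R : realType)
    (Q : probability O R) (Z : {RV Q >-> nat}) (lambda : R) : Prop :=
  forall k : nat, Q (Z @^-1` [set k]) = (poisson_pmf lambda k)%:E.

(* Main.v *)
From HB Require Import structures.
Require Import Defs.
From mathcomp Require Import all_boot all_order all_algebra perm.
From mathcomp Require Import all_classical all_reals all_analysis measurable_realfun.
From mathcomp Require Import ring lra zify.

Set Implicit Arguments.
Unset Strict Implicit.
Unset Printing Implicit Defensive.

Import Order.TTheory GRing.Theory Num.Theory.
Import numFieldNormedType.Exports.

Local Open Scope classical_set_scope.
Local Open Scope ring_scope.

(** The proof is Stein's method for the Poisson law, with local dependence.

    For a test function f with Poisson mean m, let g solve the Stein equation
    lambda g(k + 1) - k g(k) = f(k) - m, so that the error E f(S) - m equals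
    lambda E g(S + 1) - E (S g(S)). Write S as the sum over the index sets V of
    cardinality l of the indicator xi(V) that the kernel is 1 on the points of V,
    and let S(V) be the sum over the sets disjoint from V. As xi(V) and S(V) are
    independent, E (xi(V) g(S)) and E xi(V) E g(S + 1) can both be compared with
    E xi(V) E g(S(V) + 1). If the increments of g beyond s are at most w(s), the
    two errors are at most the mean of w(S(V)) times, respectively,
    the sum of xi(V) xi(U) over U meeting V and different from V, and E xi(V) times
    the sum of xi(U) over U meeting V. For w a combination of
    indicators of {s <= k}, one may further decrease S(V) to the U-statistic of
    n - 2 l points outside V and U: this is independent of the pair and has the law of
    the U-statistic of the smaller process, whence the factors P(S' <= k). This is
    [dissociated_stein_chen].

    The double sums are then computed. Conditionally on the i common points, the
    remaining parts of V and U are independent, so E (xi(V) xi(U)) is the integral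
    of a square in r ([overlap_pairE]); grouping the sets U by their trace on V
    gives 2 ^ l r / l!. The sum of the products E xi(V) E xi(U) is lambda ^ 2 times
    the proportion of sets meeting a given one, at most l ^ 2 / n
    ([card_meeting]). Together this is lambda B ([ustat_stein]).

    It remains to bound the increments of g. Everything follows from the identity
    [steinB], which expresses the increment at k by the means of (Z - k)^+ and
    (k - Z)^+ and by those of f(Z) - f(k) on Z < k and on Z > k. For indicators it
    gives min(1, 1 / lambda). For the indicator of an initial segment 0, ..., v,
    the solution beyond v is a ratio of a Poisson tail and a Poisson weight,
    nonnegative and decreasing, which gives the last two claims. For Lipschitz
    functions it reduces the bound to one explicit number for each k. That number
    is twice the integral of (1 - s) p(s) for s between 0 and 1, with p(s) a point
    probability of an immigration-death process, hence at most the largest weight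
    of a Poisson law with mean lambda s, which is at most (2 e lambda s)^(-1/2).
    Integrating gives 8 / (3 (2 e lambda)^(1/2)), below 1.1437 / lambda^(1/2). *)

(** * Poisson weights *)

HB.lock Definition pois {R : realType} (x : R) (j : nat) : R :=
  x ^+ j / j`!%:R * expR (- x).

Section poisson_weights.
Context {R : realType}.
Implicit Types (x : R) (j k : nat).

Definition pois_lt x k : R := \sum_(j < k) pois x j.

Definition pois_ge x k : R := 1 - pois_lt x k.

Lemma pois_pmfE x j : 0 < x -> poisson_pmf x j = pois x j.
Proof. by rewrite pois.unlock /poisson_pmf => ->. Qed.

Lemma pois_ge0 x j : 0 <= x -> 0 <= pois x j.
Proof. by move=> x0; rewrite pois.unlock mulr_ge0 ?expR_ge0// divr_ge0 ?exprn_ge0. Qed.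

Lemma pois_gt0 x j : 0 < x -> 0 < pois x j.
Proof. by move=> x0; rewrite pois.unlock mulr_gt0 ?expR_gt0// divr_gt0 ?exprn_gt0// ltr0n fact_gt0. Qed.

Lemma factr_neq0 k : k`!%:R != 0 :> R.
Proof. by rewrite pnatr_eq0 -lt0n fact_gt0. Qed.

Lemma poisS x j : j.+1%:R * pois x j.+1 = x * pois x j.
Proof.
rewrite pois.unlock factS natrM exprS.
have j0 := factr_neq0 j; have j1 : j.+1%:R != 0 :> R by rewrite pnatr_eq0.
move: (j.+1%:R) j1 (j`!%:R) j0 => a a0 b b0.
by field; rewrite a0 b0.
Qed.

Lemma pois_ltS x k : pois_lt x k.+1 = pois_lt x k + pois x k.
Proof. by rewrite /pois_lt big_ord_recr. Qed.

Lemma pois_lt0 x : pois_lt x 0 = 0.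
Proof. by rewrite /pois_lt big_ord0. Qed.

Lemma pois_geS x k : pois_ge x k.+1 = pois_ge x k - pois x k.
Proof. by rewrite /pois_ge pois_ltS opprD addrA. Qed.

Lemma pois_lt_ge0 x k : 0 <= x -> 0 <= pois_lt x k.
Proof. by move=> x0; apply: sumr_ge0 => j _; exact: pois_ge0. Qed.

Lemma pois_lt_cvg x : pois_lt x k @[k --> \oo] --> (1 : R).
Proof.
have -> : (1 : R) = expR x * expR (- x) by rewrite expRxMexpNx_1.
have -> : pois_lt x = series (exp_coeff x) \* cst (expR (- x)).
  apply/funext => k; rewrite /pois_lt /series /= big_mkord mulr_suml.
  by apply: eq_bigr => j _; rewrite pois.unlock /exp_coeff.
by apply: cvgM; [exact: is_cvg_series_exp_coeff | exact: cvg_cst].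
Qed.

Lemma pois_lt_homo x : 0 <= x -> {homo pois_lt x : j k / (j <= k)%N >-> j <= k}.
Proof.
move=> x0; apply: homo_leq => // [? ? ?|k]; first exact: le_trans.
by rewrite pois_ltS lerDl pois_ge0.
Qed.

Lemma pois_lt_le1 x k : 0 <= x -> pois_lt x k <= 1.
Proof.
move=> x0; rewrite -(cvg_lim _ (pois_lt_cvg x)) //.
apply: limr_ge; first by apply/cvg_ex; exists 1; exact: pois_lt_cvg.
by near=> N; apply: pois_lt_homo => //; near: N; exact: nbhs_infty_ge.
Unshelve. all: by end_near. Qed.

Lemma pois_ge_ge0 x k : 0 <= x -> 0 <= pois_ge x k.
Proof. by move=> x0; rewrite subr_ge0 pois_lt_le1. Qed.

Lemma pois_ge_le1 x k : 0 <= x -> pois_ge x k <= 1.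
Proof. by move=> x0; rewrite lerBlDr lerDl pois_lt_ge0. Qed.

(** Termwise, [k.+1 * pois x j.+1 <= x * pois x j] for every j at least k; the
    inequality between the tails is the limit of the sums of these. *)
Lemma pois_tail x k : 0 <= x -> k.+1%:R * pois_ge x k.+1 <= x * pois_ge x k.
Proof.
move=> x0.
pose u N := x * (pois_lt x N - pois_lt x k) - k.+1%:R * (pois_lt x N.+1 - pois_lt x k.+1).
have cu : u N @[N --> \oo] --> x * (1 - pois_lt x k) - k.+1%:R * (1 - pois_lt x k.+1).
  apply: cvgB; apply: cvgMr; apply: cvgB; try exact: cvg_cst.
  - exact: pois_lt_cvg.
  - by have := pois_lt_cvg x; rewrite -(cvg_shiftS (pois_lt x)).
rewrite -subr_ge0 /pois_ge -(cvg_lim _ cu)//.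
apply: limr_ge; first by apply/cvg_ex; eexists; exact: cu.
exists k => // N /= kN; rewrite /u.
elim: N kN => [|N IH]; first by rewrite leqn0 => /eqP ->; rewrite !subrr !mulr0 subrr.
rewrite leq_eqVlt => /orP[/eqP->|]; first by rewrite !subrr !mulr0 subrr.
rewrite ltnS => kN; have {IH} := IH kN; move=> IH.
apply: le_trans IH _; rewrite !(pois_ltS _ N.+1) (pois_ltS _ N) -subr_ge0.
set a := pois_lt _ _; set b := pois_lt _ _; set c := pois_lt _ _.
have -> : x * (a + pois x N - b) - k.+1%:R * (a + pois x N + pois x N.+1 - c) -
  (x * (a - b) - k.+1%:R * (a + pois x N - c)) =
  x * pois x N - k.+1%:R * pois x N.+1 by ring.
by rewrite -poisS -mulrBl mulr_ge0 ?pois_ge0// subr_ge0 ler_nat.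
Qed.

Lemma pois_ge_le_pow x k : 0 <= x -> pois_ge x k <= x ^+ k / k`!%:R.
Proof.
move=> x0; elim: k => [|k IH]; first by rewrite expr0 divr1 pois_ge_le1.
have k0 : 0 < k.+1%:R :> R by rewrite ltr0n.
rewrite -(ler_pM2l k0) (le_trans (pois_tail k x0))//.
apply: le_trans (ler_wpM2l x0 IH) _.
rewrite factS natrM exprS le_eqVlt; apply/orP; left; apply/eqP.
move: (factr_neq0 k) (lt0r_neq0 k0); move: (_%:R) (_%:R) => b a b0 a0.
by field; rewrite a0 b0.
Qed.

End poisson_weights.

(** * Solutions of the Stein equation for the Poisson law *)

Section stein_solution.
Context {R : realType}.
Implicit Types (x m : R) (f : nat -> R) (j k : nat).

(** For k positive, the solution for the test function f centred at m, where m
    stands for the mean of f under the Poisson law; keeping m free avoids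
    infinite sums. *)
Fixpoint stein x f m k : R :=
  if k is k'.+1 then (k'%:R * stein x f m k' + f k' - m) / x else 0.

Lemma steinE x f m k : x != 0 ->
  x * stein x f m k.+1 - k%:R * stein x f m k = f k - m.
Proof. by move=> x0 /=; rewrite mulrC divfK//; ring. Qed.

Lemma stein_sum x f m k : x != 0 ->
  k%:R * pois x k * stein x f m k = \sum_(j < k) pois x j * (f j - m).
Proof.
move=> x0; elim: k => [|k IH]; first by rewrite !mul0r big_ord0.
rewrite big_ord_recr /= -IH poisS; field.
exact: x0.
Qed.

(** [pois_below x k] and [pois_above x k] are the expectations of the positive
    and negative parts of [k - Z], for Z Poisson with mean x. *)
Definition pois_below x k : R := k%:R * pois x k + (k%:R - x) * pois_lt x k.

Definition pois_above x k : R := k%:R * pois x k + (x - k%:R) * pois_ge x k.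

Lemma pois_belowE x k : pois_below x k = \sum_(j < k) (k%:R - j%:R) * pois x j.
Proof.
elim: k => [|k IH]; first by rewrite big_ord0 /pois_below pois_lt0 mul0r mulr0 addr0.
rewrite big_ord_recr /= (eq_bigr (fun j : 'I_k => (k%:R - j%:R) * pois x j + pois x j)).
  rewrite big_split /= -IH -/(pois_lt x k) /pois_below poisS pois_ltS -natr1.
  ring.
by move=> j _; rewrite -natr1; ring.
Qed.

Lemma pois_below_ge0 x k : 0 <= x -> 0 <= pois_below x k.
Proof.
move=> x0; rewrite pois_belowE; apply: sumr_ge0 => j _.
by rewrite mulr_ge0 ?pois_ge0// subr_ge0 ler_nat ltnW.
Qed.

Lemma pois_belowS x k : pois_below x k = k%:R * pois_lt x k.+1 - x * pois_lt x k.
Proof. by rewrite pois_ltS /pois_below; ring. Qed.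

Lemma pois_aboveS x k : pois_above x k = x * pois_ge x k - k%:R * pois_ge x k.+1.
Proof. by rewrite pois_geS /pois_above; ring. Qed.

Lemma pois_above_ge0 x k : 0 <= x -> 0 <= pois_above x k.
Proof.
move=> x0; rewrite pois_aboveS subr_ge0; apply: le_trans (pois_tail k x0).
by rewrite ler_wpM2r ?pois_ge_ge0// ler_nat.
Qed.

Lemma pois_aboveB x k : pois_above x k - pois_below x k = x - k%:R.
Proof. by rewrite /pois_above /pois_below /pois_ge; ring. Qed.

(** The two sums are the expectations of [f Z - f k] on the events Z < k and
    Z > k. All Stein factors below are read off from this identity. *)
Lemma steinB x f m k : x != 0 ->
  x * (k%:R * pois x k) * (stein x f m k.+1 - stein x f m k) =
  - ((\sum_(j < k) pois x j * (f j - f k)) * pois_above x k +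
     (m - \sum_(j < k) pois x j * f j - f k * pois_ge x k) * pois_below x k).
Proof.
move=> x0.
have -> : x * (k%:R * pois x k) * (stein x f m k.+1 - stein x f m k) =
  k%:R * pois x k * (f k - m) +
  (k%:R - x) * (k%:R * pois x k * stein x f m k).
  by rewrite -(steinE f m k x0); ring.
rewrite stein_sum//.
have sumB c : \sum_(j < k) pois x j * (f j - c) =
    \sum_(j < k) pois x j * f j - c * pois_lt x k.
  rewrite [c * _]mulrC [X in _ - X]mulr_suml -sumrB.
  by apply: eq_bigr => j _; rewrite mulrBr.
by rewrite !sumB /pois_above /pois_below /pois_ge; ring.
Qed.

(** As [f j - f k] has absolute value at most 1 for an indicator f, the two
    expectations in [steinB] are at most [pois_lt x k] and [pois_ge x k.+1]; with
    these values the right-hand side collapses to a multiple of [pois x k]. The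
    hypothesis on m says that it could be the Poisson measure of A. *)
Lemma stein_indicator_step x (A : pred nat) m k : 0 < x -> (0 < k)%N ->
  (forall i, \sum_(j < i) pois x j * (A j)%:R <= m <=
             \sum_(j < i) pois x j * (A j)%:R + pois_ge x i) ->
  `|stein x (fun j => (A j)%:R) m k.+1 - stein x (fun j => (A j)%:R) m k| <=
  Num.min 1 x^-1.
Proof.
pose f j : R := (A j)%:R; rewrite -/f.
move=> x0 k0 Am; have x0' := lt0r_neq0 x0; have x0'' := ltW x0.
have kR : 1 <= k%:R :> R by rewrite ler1n.
have kR0 : 0 < k%:R :> R by rewrite ltr0n.
have pk := pois_gt0 k x0.
suff H : x * k%:R * `|stein x f m k.+1 - stein x f m k| <=
    x * pois_lt x k + k%:R * pois_ge x k.+1.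
  rewrite le_min; apply/andP; split.
    rewrite -(ler_pM2l (mulr_gt0 x0 kR0)) (le_trans H)//.
    have := pois_above_ge0 k x0''; rewrite pois_aboveS subr_ge0 => Ha.
    apply: le_trans (_ : x <= _); last by rewrite mulr1 ler_peMr.
    by move: Ha; rewrite {2}/pois_ge; lra.
  rewrite -(ler_pM2l (mulr_gt0 x0 kR0)) (le_trans H)//.
  have := pois_below_ge0 k x0''; rewrite pois_belowS subr_ge0 => Hb.
  rewrite mulrAC mulfV// mul1r.
  by move: Hb; rewrite /pois_ge; lra.
rewrite -(ler_pM2r pk).
have -> : x * k%:R * `|stein x f m k.+1 - stein x f m k| * pois x k =
    `|x * (k%:R * pois x k) * (stein x f m k.+1 - stein x f m k)|.
  rewrite normrM (ger0_norm (_ : 0 <= x * (k%:R * pois x k))); first by ring.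
  by rewrite mulr_ge0// mulr_ge0// pois_ge0.
rewrite steinB// normrN.
have -> : (x * pois_lt x k + k%:R * pois_ge x k.+1) * pois x k =
    pois_lt x k * pois_above x k + pois_ge x k.+1 * pois_below x k.
  by rewrite pois_aboveS pois_belowS pois_geS pois_ltS /pois_ge; ring.
have a0 := pois_above_ge0 k x0''; have b0 := pois_below_ge0 k x0''.
have := Am k.+1; rewrite big_ord_recr /=.
set s := \sum_(j < k) pois x j * (A j)%:R.
move=> /andP[Am1 Am2].
have s0 : 0 <= s by apply: sumr_ge0 => j _; rewrite mulr_ge0// pois_ge0.
have s1 : s <= pois_lt x k.
  by apply: ler_sum => j _; rewrite ler_piMr ?pois_ge0// lern1 leq_b1.
have -> : \sum_(j < k) pois x j * (f j - f k) = s - f k * pois_lt x k.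
  rewrite [f k * _]mulrC [X in _ - X]mulr_suml -sumrB.
  by apply: eq_bigr => j _; rewrite mulrBr.
have gk := pois_geS x k.
have -> : pois_ge x k = pois_ge x k.+1 + pois x k by rewrite gk subrK.
rewrite (le_trans (ler_normD _ _))// !normrM (ger0_norm a0) (ger0_norm b0).
rewrite lerD// ler_wpM2r//; move: Am1 Am2; rewrite /f; case: (A k) => /= Am1 Am2;
  rewrite ler_norml; apply/andP; split; lra.
Qed.

(** The extremal f is the distance to k, for which both terms of [steinB] equal
    [pois_above x k * pois_below x k]. The hypothesis on m bounds the mean of
    [f Z - f k] on the event that Z is at least k. *)
Lemma stein_lipschitz_step x f m k : 0 < x -> (0 < k)%N ->
  (forall a b : nat, `|f a - f b| <= `|a%:R - b%:R|) ->
  `|m - \sum_(j < k) pois x j * f j - f k * pois_ge x k| <= pois_above x k ->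
  `|stein x f m k.+1 - stein x f m k| <=
  2 * pois_above x k * pois_below x k / (x * (k%:R * pois x k)).
Proof.
move=> x0 k0 lf fm; have x0' := lt0r_neq0 x0; have x0'' := ltW x0.
have p0 : 0 < x * (k%:R * pois x k).
  by rewrite mulr_gt0// mulr_gt0 ?ltr0n// pois_gt0.
rewrite ler_pdivlMr// mulrC -[X in X * `|_|](gtr0_norm p0) -normrM steinB// normrN.
have a0 := pois_above_ge0 k x0''; have b0 := pois_below_ge0 k x0''.
rewrite (le_trans (ler_normD _ _))// !normrM (ger0_norm a0) (ger0_norm b0).
have -> : 2 * pois_above x k * pois_below x k =
  pois_below x k * pois_above x k + pois_above x k * pois_below x k by ring.
rewrite lerD// ler_wpM2r//.
rewrite pois_belowE (le_trans (ler_norm_sum _ _ _))//; apply: ler_sum => j _.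
rewrite normrM ger0_norm ?pois_ge0// mulrC ler_wpM2r ?pois_ge0//.
apply: le_trans (lf _ _) _; rewrite distrC ger0_norm// subr_ge0 ler_nat.
exact: ltnW.
Qed.

Lemma dist_from_steps (g : nat -> R) (M : R) s :
  (forall k, (s < k)%N -> `|g k.+1 - g k| <= M) ->
  forall a b, (s < a)%N -> (s < b)%N -> `|g a - g b| <= M * `|a%:R - b%:R|.
Proof.
move=> step.
have up a i : (s < a)%N -> `|g (a + i)%N - g a| <= M * i%:R.
  move=> sa; elim: i => [|i IH]; first by rewrite addn0 subrr normr0 mulr0.
  rewrite addnS -(subrKA (g (a + i)%N)) (le_trans (ler_normD _ _))//.
  by rewrite -natr1 mulrDr mulr1 addrC lerD// step// ltn_addr.
move=> a b; wlog ab : a b / (a <= b)%N.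
  move=> H sa sb; case/orP: (leq_total a b) => ?; first exact: H.
  by rewrite distrC [`|a%:R - _|]distrC; exact: H.
move=> sa sb; rewrite -(subnKC ab) distrC (le_trans (up _ _ sa))//.
by rewrite natrD [`|_ - (_ + _)|]distrC addrAC subrr add0r ger0_norm.
Qed.

End stein_solution.

Section stein_initial_segment.
Context {R : realType}.
Variables (x : R) (v : nat).
Hypothesis x0 : 0 < x.

Let g := stein x (fun j => (j <= v)%:R) (pois_lt x v.+1).

Let xneq0 : x != 0. Proof. exact: lt0r_neq0. Qed.

Let xge0 : 0 <= x. Proof. exact: ltW. Qed.

Lemma stein_segmentE k : (v < k)%N ->
  g k = pois_lt x v.+1 * pois_ge x k / (k%:R * pois x k).
Proof.
move=> vk; have kp : k%:R * pois x k != 0.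
  by rewrite mulf_neq0 ?(lt0r_neq0 (pois_gt0 k x0))// pnatr_eq0 -lt0n (leq_ltn_trans _ vk).
apply: (mulfI kp); rewrite stein_sum// [RHS]mulrC divfK//.
transitivity (\sum_(j < k) pois x j * (j <= v)%:R - pois_lt x v.+1 * pois_lt x k).
  rewrite [_ * pois_lt _ k]mulrC [X in _ - X]mulr_suml -sumrB.
  by apply: eq_bigr => j _; rewrite mulrBr.
suff -> : \sum_(j < k) pois x j * (j <= v)%:R = pois_lt x v.+1.
  by rewrite /pois_ge mulrBr mulr1.
rewrite /pois_lt (big_ord_widen k (fun j => pois x j))// [RHS]big_mkcond /=.
by apply: eq_bigr => j _; rewrite ltnS; case: leqP; rewrite ?mulr1 ?mulr0.
Qed.

Lemma stein_segment_ge0 k : (v < k)%N -> 0 <= g k.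
Proof.
move=> vk; rewrite stein_segmentE// divr_ge0//.
  by rewrite mulr_ge0 ?pois_lt_ge0 ?pois_ge_ge0.
by rewrite mulr_ge0 ?pois_ge0.
Qed.

Lemma stein_segment_decr k : (v < k)%N -> g k.+1 <= g k.
Proof.
move=> vk; rewrite !stein_segmentE// ?leqW// -!mulrA ler_wpM2l ?pois_lt_ge0//.
have k0 : 0 < k%:R :> R by rewrite ltr0n (leq_ltn_trans _ vk).
have pk := pois_gt0 k x0.
rewrite poisS ler_pdivrMr ?mulr_gt0//.
have -> : pois_ge x k / (k%:R * pois x k) * (x * pois x k) = x * pois_ge x k / k%:R.
  move: (pois x k) pk (pois_ge x k) => p p0 q.
  by field; rewrite !lt0r_neq0.
rewrite ler_pdivlMr// mulrC; apply: le_trans (pois_tail k xge0).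
by rewrite ler_wpM2r ?pois_ge_ge0// ler_nat.
Qed.

Lemma stein_segment_homo a b : (v < a)%N -> (a <= b)%N -> g b <= g a.
Proof.
move=> va; elim: b => [|b IH]; first by rewrite leqn0 => /eqP ->.
rewrite leq_eqVlt => /orP[/eqP->//|]; rewrite ltnS => ab.
by apply: le_trans (IH ab); apply: stein_segment_decr; exact: leq_trans va ab.
Qed.

(** As the solution is nonnegative and nonincreasing beyond v, all its
    oscillation beyond s is at most its value at [s.+1]. *)
Lemma stein_segment_dist s a b : (v <= s)%N -> (s < a)%N -> (s < b)%N ->
  `|g a - g b| <= g s.+1 * `|a%:R - b%:R|.
Proof.
move=> vs; wlog ab : a b / (a < b)%N.
  move=> H; have [ab|ba|->] := ltngtP a b; first exact: H.
  - by move=> sa sb; rewrite distrC [`|a%:R - _|]distrC; exact: H.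
  - by rewrite !subrr !normr0 mulr0.
move=> sa sb; have va : (v < a)%N by exact: leq_ltn_trans sa.
have gs0 : 0 <= g s.+1 by apply: stein_segment_ge0; rewrite ltnS.
rewrite ger0_norm; last by rewrite subr_ge0 stein_segment_homo// ltnW.
apply: le_trans (_ : g s.+1 <= _); last first.
  rewrite ler_peMr// distrC ger0_norm; last by rewrite subr_ge0 ler_nat ltnW.
  by rewrite lerBrDl natr1 ler_nat.
rewrite lerBlDr (le_trans (stein_segment_homo _ sa))// ?ltnS//.
by rewrite lerDl stein_segment_ge0// (ltn_trans va).
Qed.

(** As x is at least v.+1, the weights [pois x j] increase up to j = v, so that
    each of the v.+1 terms of the distribution function at v is at most
    [pois x v]; this is where the factors v.+1 come from. *)
Lemma stein_segment_step_tail s : v.+1%:R <= x -> (v < s)%N ->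
  g s.+1 <= v.+1%:R ^+ 2 / x ^+ 2.
Proof.
move=> vx vs; have pv := pois_gt0 v x0.
apply: le_trans (stein_segment_homo _ (_ : (v.+2 <= s.+1)%N)) _ => //.
rewrite stein_segmentE// poisS.
have pv1 : pois x v.+1 = x * pois x v / v.+1%:R.
  by rewrite -poisS mulrC mulKf// pnatr_eq0.
have mono j : (j <= v)%N -> pois x j <= pois x v.
  have step i : (i < v)%N -> pois x i <= pois x i.+1.
    move=> iv; rewrite -(ler_pM2l x0) -poisS ler_wpM2r ?pois_ge0//.
    by apply: le_trans vx; rewrite ler_nat ltnW.
  move=> jv; rewrite -(subnKC jv) in step *; elim: (v - j)%N step => [|i IH] step.
    by rewrite addn0.
  rewrite addnS; apply: le_trans (step _ _); last by rewrite addnS.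
  by apply: IH => k ki; apply: step; rewrite addnS ltnW.
have Fv : pois_lt x v.+1 <= v.+1%:R * pois x v.
  rewrite mulrC mulr_natr -[v.+1 in leRHS]card_ord -sumr_const.
  by apply: ler_sum => j _; rewrite mono// -ltnS.
rewrite pv1 ler_pdivrMr; last by rewrite !mulr_gt0// ?invr_gt0 ?ltr0n.
have -> : v.+1%:R ^+ 2 / x ^+ 2 * (x * (x * pois x v / v.+1%:R)) = v.+1%:R * pois x v.
  have v0 : v.+1%:R != 0 :> R by rewrite pnatr_eq0.
  by move: (v.+1%:R) v0 => a a0; field; rewrite a0 xneq0.
apply: le_trans Fv; rewrite ler_piMr ?pois_lt_ge0 ?pois_ge_le1//.
Qed.

End stein_initial_segment.

(** For v = 0 the value at [k.+1] is [pois_ge x k.+1 * k`!%:R / x ^+ k.+1]; the two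
    bounds use that the tail is at most 1 and at most [x ^+ k.+1 / k.+1`!%:R]. *)
Lemma stein_point0_le {R : realType} (x : R) k : 0 < x ->
  x * stein x (fun j => (j <= 0)%:R) (pois_lt x 1) k.+1 <=
  Num.min (x / k.+1%:R) (k`!%:R / x ^+ k).
Proof.
move=> x0; have xn0 := lt0r_neq0 x0; have pk := pois_gt0 k x0.
rewrite stein_segmentE// poisS pois_ltS pois_lt0 add0r.
have -> : x * (pois x 0 * pois_ge x k.+1 / (x * pois x k)) =
    pois_ge x k.+1 * (k`!%:R / x ^+ k).
  rewrite pois.unlock expr0 fact0 divr1 mul1r.
  have := expR_gt0 (- x) => /lt0r_neq0 e0.
  by field; rewrite factr_neq0 e0 xn0 expf_neq0.
have xge0 := ltW x0; have fx0 : 0 <= k`!%:R / x ^+ k by rewrite divr_ge0 ?exprn_ge0.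
rewrite le_min; apply/andP; split; last by rewrite ler_piMl// pois_ge_le1.
apply: le_trans (ler_wpM2r fx0 (pois_ge_le_pow _ xge0)) _.
rewrite factS natrM exprS le_eqVlt; apply/orP; left; apply/eqP.
have k0 : k.+1%:R != 0 :> R by rewrite pnatr_eq0.
move: (factr_neq0 (R := R) k) k0 (expf_neq0 k xn0); move: (_%:R) (_%:R) (x ^+ k) => b a y b0 a0 y0.
by field; rewrite a0 b0 y0.
Qed.

(** * The mode of a Poisson law *)

Section poisson_mode.
Context {R : realType}.
Implicit Types (x z : R) (j k : nat).

Lemma derivable_nondecr (f df : R -> R) (a b : R) : a <= b ->
  (forall x, a <= x <= b -> is_derive x 1 f (df x)) ->
  (forall x, a < x < b -> 0 <= df x) -> f a <= f b.
Proof.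
move=> ab fdf df0.
have cf : {within `[a, b], continuous f}.
  apply: derivable_within_continuous => y; rewrite in_itv => /fdf fy.
  exact: ex_derive.
apply: (@ger0_derive1_ndecr R f a b) => //.
- by move=> y; rewrite in_itv /= => /andP[/ltW ay /ltW yb];
    have fy := fdf y (introT andP (conj ay yb)); exact: ex_derive.
- move=> y; rewrite in_itv /= => yab; have /andP[/ltW ay /ltW yb] := yab.
  have fy := fdf y (introT andP (conj ay yb)).
  by rewrite derive1E (@derive_val _ _ _ _ _ _ _ fy) df0.
Qed.

(** The difference of the two sides vanishes at 0 and has derivative
    [- ln (1 - z ^+ 2)]. With z = 1 / (2 (j + 1)) this compares the peaks of two
    consecutive Poisson weights. *)
Lemma entropy_le z : 0 <= z < 1 ->
  (1 + z) * ln (1 + z) - (1 - z) * ln (1 - z) <= 2 * z.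
Proof.
move=> /andP[z0 z1]; rewrite -subr_ge0.
pose f y : R := 2 * y - ((1 + y) * ln (1 + y) - (1 - y) * ln (1 - y)).
have -> : 0 = f 0 by rewrite /f !addr0 subr0 ln1 !mulr0 !subr0.
refine (@derivable_nondecr f (fun y => - (ln (1 + y) + ln (1 - y))) 0 z z0 _ _).
- move=> y /andP[y0 yz].
  have p1 : 0 < 1 + y by rewrite ltr_wpDr.
  have p2 : 0 < 1 - y by rewrite subr_gt0 (le_lt_trans yz).
  have d1 : is_derive y 1 (fun y : R => ln (1 + y)) (1 + y)^-1.
    have := @is_derive1_comp _ (@ln R) (fun y : R => 1 + y) y (1 + y)^-1 1
      (is_derive1_ln p1).
    by rewrite mulr1; apply; apply: is_derive_eq; ring.
  have d2 : is_derive y 1 (fun y : R => ln (1 - y)) (- (1 - y)^-1).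
    have := @is_derive1_comp _ (@ln R) (fun y : R => 1 - y) y (1 - y)^-1 (-1)
      (is_derive1_ln p2).
    by rewrite mulrN1; apply; apply: is_derive_eq; ring.
  rewrite /f; apply: is_derive_eq; rewrite /GRing.scale /=.
  by field; rewrite !lt0r_neq0.
- move=> y /andP[y0 yz].
  rewrite oppr_ge0 -lnM ?posrE; last 2 first.
  + by rewrite ltr_wpDr// ltW.
  + by rewrite subr_gt0 (lt_trans yz).
  by apply: ln_le0; nra.
Qed.

(** The maximum over x is at n / 2, by [1 + t <= expR t] with t = 2 x / n - 1. *)
Lemma pow_exp_peak (n : nat) x : (0 < n)%N -> 0 <= x ->
  x ^+ n * expR (- (2 * x)) <= (n%:R / 2) ^+ n * expR (- n%:R).
Proof.
move=> n0 x0; have nR : 0 < n%:R :> R by rewrite ltr0n.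
pose y := 2 * x / n%:R.
have y0 : 0 <= y by rewrite divr_ge0// mulr_ge0.
have xE : x = n%:R / 2 * y.
  by rewrite /y; field; rewrite lt0r_neq0.
have ye : y <= expR (y - 1) by have := expR_ge1Dx (y - 1); rewrite addrC subrK.
rewrite {1}xE exprMn -mulrA ler_wpM2l ?exprn_ge0 ?divr_ge0//.
apply: le_trans (ler_wpM2r (expR_ge0 _) (lerXn2r n _ _ ye)) _; rewrite ?nnegrE ?expR_ge0//.
rewrite -expRM_natr -expRD ler_expR le_eqVlt; apply/orP; left; apply/eqP.
by rewrite xE; field.
Qed.

(** The maximum over x of [x * pois x j ^+ 2] is nonincreasing in j, and equal to
    1 / (2 e) for j = 0. *)
Lemma pois_peak j :
  2 * expR 1 * ((j.*2.+1%:R / 2) ^+ j.*2.+1 * expR (- j.*2.+1%:R)) <= j`!%:R ^+ 2 :> R.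
Proof.
elim: j => [|j IH].
  rewrite fact0 expr1n double0 expr1 -[leRHS](expRxMexpNx_1 1).
  by move: (expR 1) (expR (- 1)) => a b; lra.
rewrite factS natrM [(_ * j`!%:R) ^+ 2]exprMn.
have j1 : 0 < j.+1%:R :> R by rewrite ltr0n.
refine (le_trans _ (ler_wpM2l (exprn_ge0 2 (ltW j1)) IH)).
pose z : R := (2 * j.+1%:R)^-1.
have z0 : 0 < z by rewrite invr_gt0 mulr_gt0.
have z1 : z < 1.
  by rewrite invf_lt1 ?mulr_gt0// -natrM ltr1n mul2n doubleS.
have zE : z * (2 * j.+1%:R) = 1 by rewrite mulVf// mulf_neq0 ?lt0r_neq0.
have n1 : j.*2.+3%:R = 2 * j.+1%:R + 1 :> R by rewrite -muln2 -!natr1 natrM; ring.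
have n2 : j.*2.+1%:R = 2 * j.+1%:R - 1 :> R by rewrite -muln2 -!natr1 natrM; ring.
have c0 := lt0r_neq0 j1.
have e1 : j.+1.*2.+1%:R / 2 = j.+1%:R * (1 + z) :> R.
  by rewrite doubleS n1 /z; move: (j.+1%:R) c0 => c c0; field.
have e2 : j.*2.+1%:R / 2 = j.+1%:R * (1 - z) :> R.
  by rewrite n2 /z; move: (j.+1%:R) c0 => c c0; field.
have z1' : 0 < 1 - z by rewrite subr_gt0.
have z2' : 0 < 1 + z by rewrite addr_gt0.
have key : (1 + z) ^+ j.*2.+3 <= expR 2 * (1 - z) ^+ j.*2.+1.
  have c1 : j.*2.+3%:R = (1 + z) / z :> R.
    by rewrite n1 /z; move: (j.+1%:R) c0 => c c0; field.
  have c2 : j.*2.+1%:R = (1 - z) / z :> R.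
    by rewrite n2 /z; move: (j.+1%:R) c0 => c c0; field.
  rewrite -ler_ln ?posrE ?exprn_gt0 ?mulr_gt0 ?expR_gt0 ?exprn_gt0//.
  rewrite lnM ?posrE ?exprn_gt0 ?expR_gt0// expRK (lnXn _ z2') (lnXn _ z1').
  rewrite -(mulr_natl (ln _)) -(mulr_natl (ln (1 - z))) c1 c2.
  have := @entropy_le z; rewrite (ltW z0) z1 => /(_ isT).
  move: (ln (1 + z)) (ln (1 - z)) => a b ab.
  have -> : (1 + z) / z * a = (1 + z) * a / z by rewrite mulrAC.
  rewrite ler_pdivrMr//.
  have -> : (2 + (1 - z) / z * b) * z = 2 * z + (1 - z) * b.
    by field; rewrite lt0r_neq0.
  lra.
rewrite doubleS in e1 *; rewrite e1 e2.
have eE : expR (- j.*2.+1%:R) = expR 2 * expR (- j.*2.+3%:R) :> R.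
  by rewrite -expRD; congr expR; rewrite -!natr1; ring.
rewrite eE !exprMn.
set c := j.+1%:R; set E := expR (- _); set p := (1 + z) ^+ _; set q := (1 - z) ^+ _.
rewrite [c ^+ j.*2.+3](exprD c 2 j.*2.+1).
have k0 : 0 <= c ^+ 2 * c ^+ j.*2.+1 by rewrite mulr_ge0 ?exprn_ge0 ?(ltW j1).
move: (c ^+ 2) (c ^+ j.*2.+1) k0 => c2' c3 k0.
have -> : 2 * expR 1 * (c2' * c3 * p * E) = 2 * expR 1 * (c2' * c3) * E * p by ring.
have -> : c2' * (2 * expR 1 * (c3 * q * (expR 2 * E))) =
    2 * expR 1 * (c2' * c3) * E * (expR 2 * q) by ring.
by rewrite ler_wpM2l// mulr_ge0 ?expR_ge0// mulr_ge0// mulr_ge0 ?expR_ge0.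
Qed.

(** No Poisson weight exceeds [1 / Num.sqrt (2 * expR 1 * x)]. *)
Lemma pois_mode x j : 0 <= x -> 2 * expR 1 * x * pois x j ^+ 2 <= 1.
Proof.
move=> x0; have f0 := factr_neq0 (R := R) j.
have -> : 2 * expR 1 * x * pois x j ^+ 2 =
    2 * expR 1 * (x ^+ j.*2.+1 * expR (- (2 * x))) / j`!%:R ^+ 2.
  have -> : x ^+ j.*2.+1 = x * (x ^+ j * x ^+ j) by rewrite exprS -muln2 exprM.
  have -> : expR (- (2 * x)) = expR (- x) * expR (- x).
    by rewrite -expRD; congr expR; ring.
  rewrite pois.unlock.
  by move: (_%:R) f0 (expR (- x)) (x ^+ j) => b b0 e y; field.
rewrite ler_pdivrMr ?exprn_gt0 ?ltr0n ?fact_gt0// mul1r.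
apply: le_trans (pois_peak j); rewrite ler_wpM2l ?mulr_ge0 ?expR_ge0//.
exact: pow_exp_peak.
Qed.

End poisson_mode.

(** * The Stein factor for Lipschitz functions *)

Section lipschitz_factor.
Context {R : realType}.
Implicit Types (x u s : R) (f : nat -> R) (j k : nat).

(** The expectation of f at the sum of independent Binomial(k, 1 - u) and
    Poisson(x u) variables, for f vanishing from N on: the law at time
    [- ln (1 - u)] of the immigration-death process started from k. *)
Fixpoint thinned x N k f u : R :=
  if k is k'.+1 then (1 - u) * thinned x N k' (f \o succn) u + u * thinned x N k' f u
  else \sum_(j < N) f j * pois (x * u) j.

Definition fwd f j : R := f j.+1 - f j.

Lemma thinned_fwd x N k f u :
  thinned x N k (fwd f) u = thinned x N k (f \o succn) u - thinned x N k f u.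
Proof.
elim: k f => [|k IH] f /=.
  by rewrite -sumrB; apply: eq_bigr => j _; rewrite mulrBl.
by rewrite -[fwd f \o succn]/(fwd (f \o succn)) !IH; ring.
Qed.

Lemma thinnedS x N k f u :
  thinned x N k.+1 f u = thinned x N k f u + (1 - u) * thinned x N k (fwd f) u.
Proof. by rewrite thinned_fwd /=; ring. Qed.

Lemma is_derive_pois x u j :
  is_derive u 1 (fun u => pois (x * u) j)
    (x * ((if j is j'.+1 then pois (x * u) j' else 0) - pois (x * u) j)).
Proof.
have dl (y : R) : is_derive y 1 (fun u : R => x * u) x.
  by apply: is_derive_eq; rewrite /GRing.scale /= mulr1.
have dN : is_derive u 1 (fun u : R => - (x * u)) (- x) by apply: is_derive_eq.
have dE : is_derive u 1 (fun u => expR (- (x * u))) (expR (- (x * u)) * - x).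
  exact: (@is_derive1_comp _ (@expR R) (fun u => - (x * u)) u).
have dX : is_derive u 1 (fun u => (x * u) ^+ j) (j%:R * (x * u) ^+ j.-1 * x).
  have -> : (fun u => (x * u) ^+ j) = (fun u => x * u) ^+ j.
    by rewrite exprfctE.
  have d := dl u; exact: is_deriveX.
have -> : (fun u => pois (x * u) j) =
    (fun u => (x * u) ^+ j * (j`!%:R^-1 * expR (- (x * u)))).
  by apply/funext => y; rewrite pois.unlock mulrA.
apply: is_derive_eq; rewrite /GRing.scale /= pois.unlock.
case: j {dX} => [|j] /=.
  by rewrite fact0 !expr0; field.
rewrite factS natrM exprS.
have := factr_neq0 (R := R) j; have j1 : j.+1%:R != 0 :> R by rewrite pnatr_eq0.
move: (j.+1%:R) j1 (j`!%:R) ((x * u) ^+ j) (expR _) => a a0 b y e b0.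
by field; rewrite a0 b0.
Qed.

(** The generator of the immigration-death process: immigration contributes the
    term with x, each of the k initial individuals dies at the same rate. *)
Lemma is_derive_thinned x N k f u : (forall j, (N <= j)%N -> f j = 0) ->
  is_derive u 1 (thinned x N k f)
    (x * thinned x N k (fwd f) u - k%:R * thinned x N k.-1 (fwd f) u).
Proof.
elim: k f => [|k IH] f fN.
  rewrite mul0r subr0.
  have -> : thinned x N 0 f = \sum_(j < N) (fun u => f j * pois (x * u) j).
    by apply/funext => y; rewrite fct_sumE.
  have d (j : 'I_N) := is_derive_pois x u j.
  have dd (j : 'I_N) : is_derive u 1 (fun u => f j * pois (x * u) j)
      (f j * (x * ((if val j is j'.+1 then pois (x * u) j' else 0) - pois (x * u) j))).
    by have := d j => dj; apply: is_derive_eq; rewrite /GRing.scale /=; ring.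
  apply: is_derive_eq.
  have shift : \sum_(j < N) f j * (if val j is j'.+1 then pois (x * u) j' else 0) =
      \sum_(j < N) f j.+1 * pois (x * u) j.
    case: N fN {d dd} => [|N] fN; first by rewrite !big_ord0.
    by rewrite big_ord_recl /= mulr0 add0r [RHS]big_ord_recr /= fN// mul0r addr0.
  have -> : thinned x N 0 (fwd f) u =
      \sum_(j < N) f j.+1 * pois (x * u) j - \sum_(j < N) f j * pois (x * u) j.
    by rewrite /= -sumrB; apply: eq_bigr => j _; rewrite mulrBl.
  rewrite -shift mulrBr 2!mulr_sumr -sumrB.
  by apply: eq_bigr => j _; rewrite mulrCA !mulrBr.
have fSN j : (N <= j)%N -> (f \o succn) j = 0 by move=> Nj /=; rewrite fN// leqW.
have d1 := IH _ fSN; have d2 := IH _ fN.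
have -> : thinned x N k.+1 f =
    (fun u => (1 - u) * thinned x N k (f \o succn) u + u * thinned x N k f u) by [].
have e1 : thinned x N k.+1 (fwd f) u =
  (1 - u) * thinned x N k (fwd (f \o succn)) u + u * thinned x N k (fwd f) u by [].
have e2 : k%:R * thinned x N k (fwd f) u =
    k%:R * ((1 - u) * thinned x N k.-1 (fwd (f \o succn)) u +
            u * thinned x N k.-1 (fwd f) u) by case: (k) => [|//]; rewrite !mul0r.
have e3 := thinned_fwd x N k f u.
apply: is_derive_eq; rewrite /GRing.scale -[k.+1.-1]/k e1 -natr1 [(k%:R + 1) * _]mulrDl e2 /= mul1r e3.
move: (thinned x N k.-1 _ u) (thinned x N k.-1 _ u) => a b.
move: (thinned x N k _ u) (thinned x N k _ u) => c1 c2.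
ring.
Qed.

(** A weight distribution cannot exceed the mode of the Poisson part. *)
Lemma thinned_le_mode x N k f u (M : R) : 0 <= u <= 1 -> 0 <= x * u ->
  (forall j, pois (x * u) j <= M) ->
  (forall j, 0 <= f j) -> (forall n, \sum_(j < n) f j <= 1) ->
  thinned x N k f u <= M.
Proof.
move=> /andP[u0 u1] xu0 piM.
elim: k f => [|k IH] f f0 f1 /=.
  apply: le_trans (_ : \sum_(j < N) f j * M <= _).
    by apply: ler_sum => j _; rewrite ler_wpM2l.
  by rewrite -mulr_suml ler_piMl// (le_trans _ (piM 0))// pois_ge0.
apply: le_trans (_ : (1 - u) * M + u * M <= _); last by rewrite -mulrDl subrK mul1r.
apply: lerD; rewrite ler_wpM2l ?subr_ge0//; last exact: IH.
apply: IH => [j|n] /=; first exact: f0.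
by apply: le_trans (f1 n.+1); rewrite big_ord_recl lerDr.
Qed.

Lemma thinned0 x N k f : (forall j, (N <= j)%N -> f j = 0) -> thinned x N k f 0 = f k.
Proof.
elim: k f => [|k IH] f fN /=; last first.
  rewrite subr0 mul1r mul0r addr0 IH// => j Nj /=; rewrite fN// leqW //.
rewrite mulr0; case: N fN => [|N] fN; first by rewrite big_ord0 fN.
rewrite big_ord_recl big1 => [|j _]; last by rewrite pois.unlock exprS !mul0r mulr0.
by rewrite pois.unlock expr0 fact0 divr1 oppr0 expR0 !mulr1 addr0.
Qed.

Lemma thinned1 x N k f : thinned x N k f 1 = \sum_(j < N) f j * pois x j.
Proof.
elim: k => [|k IH] /=; first by rewrite mulr1.
by rewrite subrr mul0r add0r mul1r IH.
Qed.

(** For k positive and f vanishing from N on, the integral over u between 0 and s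
    of [- thinned x N k.-1 (fwd f) u]. It interpolates between 0 and the Stein
    solution; the recursion, which is the Stein equation with [thinned x N k f s]
    in place of the mean of f, makes it explicit and easy to differentiate. *)
Fixpoint stein_at x N k f s : R :=
  if k is k'.+1 then (k'%:R * stein_at x N k' f s + f k' - thinned x N k' f s) / x
  else 0.

Lemma stein_at1 x N k f :
  stein_at x N k f 1 = stein x f (\sum_(j < N) f j * pois x j) k.
Proof. by elim: k => //= k ->; rewrite thinned1. Qed.

Lemma stein_at0 x N k f : (forall j, (N <= j)%N -> f j = 0) -> stein_at x N k f 0 = 0.
Proof. by move=> fN; elim: k => //= k ->; rewrite thinned0// mulr0 add0r subrr mul0r. Qed.

Lemma is_derive_stein_at x N k f s : x != 0 -> (forall j, (N <= j)%N -> f j = 0) ->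
  is_derive s 1 (stein_at x N k.+1 f) (- thinned x N k (fwd f) s).
Proof.
move=> x0 fN; elim: k => [|k IH].
  have d := is_derive_thinned x 0 s fN.
  have -> : stein_at x N 1 f = (fun s => (f 0 - thinned x N 0 f s) * x^-1).
    by apply/funext => y /=; rewrite mul0r add0r.
  apply: is_derive_eq; rewrite /GRing.scale /=; field.
  exact: x0.
have d := is_derive_thinned x k.+1 s fN.
have -> : stein_at x N k.+2 f =
  (fun s => (k.+1%:R * stein_at x N k.+1 f s + f k.+1 - thinned x N k.+1 f s) * x^-1) by [].
move: (thinned x N k.+1 f) d (stein_at x N k.+1 f) IH => t d g IH.
apply: is_derive_eq; rewrite /GRing.scale /=.
move: (thinned x N k _ s) ((1 - s) * _ + _) => a b.
by move: (k.+1%:R) => K; field; exact: x0.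
Qed.

(** The positive part of [k.+1 - j]. Its Stein solution has at [k.+1] the increment
    that governs all Lipschitz functions, while its second difference is the
    indicator of k, so that this increment becomes an integral of point
    probabilities. *)
Let hinge k j : R := (k.+1 - j)%:R.

Let gap x k s : R := stein_at x k.+1 k.+1 (hinge k) s - stein_at x k.+1 k.+2 (hinge k) s.

Let hinge0 k j : (k.+1 <= j)%N -> hinge k j = 0.
Proof. by rewrite /hinge => /eqP ->. Qed.

Let fwd2_hinge k j : fwd (fwd (hinge k)) j = (j == k)%:R.
Proof.
rewrite /fwd /hinge; have [jk|kj|->] := ltngtP j k.
- have -> : (k.+1 - j)%N = (k.+1 - j.+2).+2 by lia.
  have -> : (k.+1 - j.+1)%N = (k.+1 - j.+2).+1 by lia.
  by rewrite /= mulr0n; move: (_ - _)%N => i; rewrite -!natr1; ring.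
- have -> : (k.+1 - j)%N = 0%N by lia.
  have -> : (k.+1 - j.+1)%N = 0%N by lia.
  have -> : (k.+1 - j.+2)%N = 0%N by lia.
  by rewrite !subrr.
- have -> : (k.+1 - k)%N = 1%N by lia.
  have -> : (k.+1 - k.+1)%N = 0%N by lia.
  have -> : (k.+1 - k.+2)%N = 0%N by lia.
  by rewrite subrr !sub0r opprK.
Qed.

Let is_derive_gap x k s : x != 0 ->
  is_derive s 1 (gap x k) ((1 - s) * thinned x k.+1 k (fwd (fwd (hinge k))) s).
Proof.
move=> x0; have d1 := is_derive_stein_at k s x0 (@hinge0 k).
have d2 := is_derive_stein_at k.+1 s x0 (@hinge0 k).
have -> : gap x k = stein_at x k.+1 k.+1 (hinge k) - stein_at x k.+1 k.+2 (hinge k) by [].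
by apply: is_derive_eq; rewrite thinnedS opprK addKr.
Qed.

Let gap0 x k : gap x k 0 = 0.
Proof. by rewrite /gap !stein_at0 ?subrr//; exact: hinge0. Qed.

Let gap1 x k : 0 < x ->
  gap x k 1 = pois_above x k.+1 * pois_below x k.+1 / (x * (k.+1%:R * pois x k.+1)).
Proof.
move=> x0; have xn0 := lt0r_neq0 x0; have p0 := lt0r_neq0 (pois_gt0 k.+1 x0).
have pp : x * (k.+1%:R * pois x k.+1) != 0 by rewrite !mulf_neq0// pnatr_eq0.
apply: (mulfI pp); rewrite [RHS]mulrC divfK// /gap !stein_at1.
set m := \sum_(j < _) _.
have mE : m = pois_below x k.+1.
  rewrite pois_belowE; apply: eq_bigr => j _.
  by rewrite /hinge natrB// ltnW.
have := steinB (hinge k) m k.+1 xn0.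
rewrite (hinge0 (leqnn _)) mul0r subr0.
rewrite (_ : \sum_(j < k.+1) pois x j * hinge k j = m); last first.
  by apply: eq_bigr => j _; rewrite mulrC.
rewrite subrr mul0r addr0 (_ : \sum_(j < k.+1) _ = m); last first.
  by apply: eq_bigr => j _; rewrite subr0 mulrC.
rewrite mE => H; rewrite -opprB mulrN H opprK; ring.
Qed.

Let fwd2_hinge_le k n : \sum_(j < n) fwd (fwd (hinge k)) j <= 1.
Proof.
suff -> : \sum_(j < n) fwd (fwd (hinge k)) j = (k < n)%:R by rewrite lern1 leq_b1.
elim: n => [|n IH]; first by rewrite big_ord0 ltn0.
rewrite big_ord_recr /= IH fwd2_hinge ltnS -natrD; congr (_%:R).
by case: ltngtP.
Qed.

Let thinned_hinge_le x k s M : 0 <= s <= 1 -> 0 <= x ->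
  (forall j, pois (x * s) j <= M) -> thinned x k.+1 k (fwd (fwd (hinge k))) s <= M.
Proof.
move=> s01 x0 piM; have /andP[s0 _] := s01; apply: thinned_le_mode => //.
- by rewrite mulr_ge0.
- by move=> j; rewrite fwd2_hinge.
Qed.

Lemma pois_le1 x j : 0 <= x -> pois x j <= 1.
Proof.
move=> x0; apply: le_trans (pois_lt_le1 j.+1 x0).
by rewrite pois_ltS lerDr pois_lt_ge0.
Qed.

(** Half of the left-hand side is the integral of (1 - s) p(s) for s between 0 and
    1, with p(s) the probability of a single value under the law described at
    [thinned]. This probability is at most 1, and at most the mode of a Poisson
    law with mean x s. The second bound is integrated after the change of
    variable s = t ^ 2, which removes the singularity at 0. *)
Lemma lipschitz_factor x k : 0 < x -> (0 < k)%N ->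
  2 * pois_above x k * pois_below x k / (x * (k%:R * pois x k)) <=
  Num.min 1 (8 / 3 / Num.sqrt (2 * expR 1 * x)).
Proof.
move=> x0; case: k => // k _; have xge0 := ltW x0; have xn0 := lt0r_neq0 x0.
rewrite -[2 * _ * _]mulrA -[2 * _ / _]mulrA -gap1//.
pose p := thinned x k.+1 k (fwd (fwd (hinge k))).
rewrite le_min; apply/andP; split.
  pose f s : R := s - s ^+ 2 / 2 - gap x k s.
  have : f 0 <= f 1.
    refine (@derivable_nondecr R f (fun s => (1 - s) * (1 - p s)) 0 1 ler01 _ _).
    - move=> s _; have d := is_derive_gap k s xn0.
      have -> : f = (fun s : R => s - s ^+ 2 * 2^-1 - gap x k s) by [].
      by apply: is_derive_eq; rewrite /GRing.scale /= -/(p s); field.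
    - move=> s /andP[s0 s1]; apply: mulr_ge0; rewrite subr_ge0; first exact: ltW.
      apply: thinned_hinge_le => // [|j]; first by rewrite !ltW.
      by rewrite pois_le1// mulr_ge0// ltW.
  by rewrite /f gap0; lra.
set c := (Num.sqrt _)^-1.
have Q0 : 0 < 2 * expR 1 * x by rewrite !mulr_gt0 ?expR_gt0.
have c0 : 0 < c by rewrite invr_gt0 sqrtr_gt0.
have c2 : c ^+ 2 * (2 * expR 1 * x) = 1.
  by rewrite exprVn sqr_sqrtr ?(ltW Q0)// mulVf// lt0r_neq0.
(* 2 t - (2 / 3) t ^ 3 is the primitive of 2 (1 - t ^ 2). *)
pose f t : R := c * (2 * t - 2 / 3 * t ^+ 3) - gap x k (t ^+ 2).
have : f 0 <= f 1.
  refine (@derivable_nondecr R f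
    (fun t => 2 * (1 - t ^+ 2) * (c - t * p (t ^+ 2))) 0 1 ler01 _ _).
  - move=> t _; have d := is_derive_gap k (t ^+ 2) xn0.
    have dsq : is_derive t 1 (fun t : R => t ^+ 2) (2 * t).
      by apply: is_derive_eq; rewrite /GRing.scale /=; ring.
    have dg : is_derive t 1 (fun t => gap x k (t ^+ 2))
        ((1 - t ^+ 2) * p (t ^+ 2) * (2 * t)).
      exact: (@is_derive1_comp _ (gap x k) (fun t => t ^+ 2) t).
    have -> : f = (fun t : R => c * (2 * t - 2 / 3 * t ^+ 3) - gap x k (t ^+ 2)) by [].
    apply: is_derive_eq; rewrite /GRing.scale /=; move: (p _) => q.
    by field.
  - move=> t /andP[t0 t1]; have t2 : t ^+ 2 <= 1 by rewrite expr_le1// ltW.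
    rewrite mulr_ge0 ?mulr_ge0 ?subr_ge0// -ler_pdivlMl// mulrC.
    apply: thinned_hinge_le => // [|j]; first by rewrite exprn_ge0 ?(ltW t0).
    rewrite ler_pdivlMr// -(ler_pXn2r (n := 2)) ?nnegrE ?mulr_ge0 ?pois_ge0 ?(ltW t0) ?(ltW c0)//;
      last by rewrite mulr_ge0 ?exprn_ge0// ltW.
    rewrite -(ler_pM2r Q0) c2.
    have := @pois_mode R (x * t ^+ 2) j; rewrite mulr_ge0 ?exprn_ge0 ?(ltW t0)//.
    move=> /(_ isT); congr (_ <= _); ring.
by rewrite /f ![0 ^+ _]expr0n /= !expr1n gap0; clearbody c; lra.
Qed.

(** The first eight terms of the exponential series; fewer would not do for
    [lipschitz_factor_numeric]. *)
Lemma expR1_ge : 685 / 252 <= expR 1 :> R.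
Proof.
have := @pois_lt_le1 R 1 8 ler01.
rewrite /pois_lt; under eq_bigr do rewrite pois.unlock expr1n mul1r.
rewrite -mulr_suml expRN ler_pdivrMr ?expR_gt0// mul1r; apply: le_trans.
rewrite !big_ord_recr big_ord0 /= fact0.
rewrite (_ : 1`! = 1)%N // (_ : 2`! = 2)%N // (_ : 3`! = 6)%N // (_ : 4`! = 24)%N //.
rewrite (_ : 5`! = 120)%N // (_ : 6`! = 720)%N // (_ : 7`! = 5040)%N //.
by lra.
Qed.

Lemma lipschitz_factor_numeric x : 0 < x ->
  8 / 3 / Num.sqrt (2 * expR 1 * x) <= (1 + 1437 / 10 ^+ 4) / Num.sqrt x :> R.
Proof.
move=> x0; have e0 := expR_ge0 (1 : R).
have sx : 0 < Num.sqrt x by rewrite sqrtr_gt0.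
rewrite sqrtrM ?mulr_ge0// invfM mulrA ler_wpM2r ?invr_ge0 ?(ltW sx)//.
have se : 0 < Num.sqrt (2 * expR 1) :> R by rewrite sqrtr_gt0 mulr_gt0 ?expR_gt0.
have k0 : 0 <= 1 + 1437 / 10 ^+ 4 :> R by lra.
have k2 : (8 / 3) ^+ 2 <= (1 + 1437 / 10 ^+ 4) ^+ 2 * (2 * (685 / 252)) :> R by lra.
move: (1 + 1437 / _) k0 k2 => K k0 k2.
rewrite ler_pdivrMr// -(ler_pXn2r (n := 2)) ?nnegrE ?mulr_ge0 ?(ltW se)//.
rewrite [(K * _) ^+ 2]exprMn sqr_sqrtr ?mulr_ge0//; apply: le_trans k2 _.
by rewrite ler_wpM2l ?exprn_ge0// ler_wpM2l// expR1_ge.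
Qed.

End lipschitz_factor.

(** * Stein's method for dissociated indicators *)

Section finite_mean.
Context {R : realFieldType} {W : finType}.
Variable mu : W -> R.
Implicit Types f g : W -> R.

Definition mean f : R := \sum_w mu w * f w.

Lemma eq_mean f g : f =1 g -> mean f = mean g.
Proof. by move=> fg; apply: eq_bigr => w _; rewrite fg. Qed.

Lemma meanD f g : mean (fun w => f w + g w) = mean f + mean g.
Proof. by rewrite /mean -big_split; apply: eq_bigr => w _; rewrite mulrDr. Qed.

Lemma meanZl c f : mean (fun w => c * f w) = c * mean f.
Proof. by rewrite /mean mulr_sumr; apply: eq_bigr => w _; rewrite mulrCA. Qed.

Lemma meanZr c f : mean (fun w => f w * c) = mean f * c.
Proof. by rewrite mulrC -meanZl; apply: eq_mean => w; rewrite mulrC. Qed.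

Lemma meanB f g : mean (fun w => f w - g w) = mean f - mean g.
Proof. by rewrite /mean -sumrB; apply: eq_bigr => w _; rewrite mulrBr. Qed.

Lemma mean_sum (J : Type) (r : seq J) (Q : pred J) (F : J -> W -> R) :
  mean (fun w => \sum_(i <- r | Q i) F i w) = \sum_(i <- r | Q i) mean (F i).
Proof.
by rewrite /mean [RHS]exchange_big; apply: eq_bigr => w _; rewrite mulr_sumr.
Qed.

Hypothesis mu0 : forall w, 0 <= mu w.

Lemma ler_mean f g : (forall w, f w <= g w) -> mean f <= mean g.
Proof. by move=> fg; apply: ler_sum => w _; rewrite ler_wpM2l. Qed.

Lemma mean_ge0 f : (forall w, 0 <= f w) -> 0 <= mean f.
Proof. by move=> f0; apply: sumr_ge0 => w _; rewrite mulr_ge0. Qed.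

Lemma ler_norm_mean f : `|mean f| <= mean (fun w => `|f w|).
Proof.
apply: le_trans (ler_norm_sum _ _ _) _; apply: ler_sum => w _.
by rewrite normrM ger0_norm.
Qed.

End finite_mean.

Section dissociated_stein_chen.
Context {R : realFieldType} {W I : finType}.
Variables (mu : W -> R) (near : rel I) (xi : I -> W -> bool).
Hypothesis mu0 : forall w, 0 <= mu w.
Hypothesis nearxx : reflexive near.

Local Notation E := (mean mu).

Definition total w : nat := \sum_i xi i w.

Definition away i w : nat := \sum_(j | ~~ near i j) xi j w.

Definition away2 i j w : nat := \sum_(k | ~~ near i k && ~~ near j k) xi k w.

Hypothesis indep : forall i k,
  E (fun w => (xi i w)%:R * (away i w == k)%:R) =
  E (fun w => (xi i w)%:R) * E (fun w => (away i w == k)%:R).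

Variable tau : nat -> R.
Hypothesis tau_pair : forall i j k, near i j -> i != j ->
  E (fun w => (xi i w)%:R * (xi j w)%:R * (away2 i j w <= k)%:R) <=
  E (fun w => (xi i w)%:R * (xi j w)%:R) * tau k.
Hypothesis tau_single : forall i j k, near i j ->
  E (fun w => (xi j w)%:R * (away2 i j w <= k)%:R) <=
  E (fun w => (xi j w)%:R) * tau k.

Variables (g : nat -> R) (cinf : R) (m : nat) (c : nat -> R).
Hypothesis c0 : forall k, 0 <= c k.
Hypothesis g_osc : forall s a b, (s < a)%N -> (s < b)%N ->
  `|g a - g b| <= (cinf + \sum_(k < m) c k * (s <= k)%:R) * `|a%:R - b%:R|.

Let wt s := cinf + \sum_(k < m) c k * (s <= k)%:R.

Let wt_away2 i j w : wt (away i w) <= wt (away2 i j w).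
Proof.
rewrite lerD2l; apply: ler_sum => k _; rewrite ler_wpM2l// ler_nat.
suff le : (away2 i j w <= away i w)%N.
  by case: (leqP (away i w) k) => // ik; rewrite (leq_trans le ik).
rewrite /away [X in (_ <= X)%N](bigID (fun k => ~~ near j k))/=.
exact: leq_addr.
Qed.

Let split_total i w : total w = (away i w + \sum_(j | near i j) xi j w)%N.
Proof. by rewrite /total (bigID (near i)) /= addnC. Qed.

Let meanM_away i (F : nat -> R) :
  E (fun w => (xi i w)%:R * F (away i w)) =
  E (fun w => (xi i w)%:R) * E (fun w => F (away i w)).
Proof.
have FE w : F (away i w) = \sum_(k < #|I|.+1) F k * (away i w == k)%:R.
  have wI : (away i w < #|I|.+1)%N.
    rewrite ltnS /away -sum1_card big_mkcond /=; apply: leq_sum => j _.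
    by case: ifP => // _; exact: leq_b1.
  rewrite (bigD1 (Ordinal wI)) //= eqxx mulr1 big1 ?addr0// => k kw.
  rewrite (_ : (_ == _) = false) ?mulr0//.
  by apply/negbTE; apply: contra kw => /eqP wk; apply/eqP/val_inj.
rewrite [X in _ = _ * X](@eq_mean _ _ _ _ _ FE) mean_sum mulr_sumr.
rewrite (@eq_mean _ _ _ _ (fun w => \sum_(k < #|I|.+1) F k * ((xi i w)%:R * (away i w == k)%:R))).
  by rewrite mean_sum; apply: eq_bigr => k _; rewrite !meanZl indep mulrCA.
by move=> w; rewrite FE mulr_sumr; apply: eq_bigr => k _; rewrite mulrCA.
Qed.

Let bnd := cinf + \sum_(k < m) c k * tau k.

(* Removing also the neighbours of j weakens the threshold events, and makes them
   behave as if independent of f. *)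
Let mean_wt (f : W -> R) i j :
  (forall w, 0 <= f w) ->
  (forall k, E (fun w => f w * (away2 i j w <= k)%:R) <= E f * tau k) ->
  E (fun w => f w * wt (away i w)) <= E f * bnd.
Proof.
move=> f0 ftau.
apply: le_trans (_ : E (fun w => f w * wt (away2 i j w)) <= _).
  by apply: ler_mean => // w; rewrite ler_wpM2l.
rewrite (@eq_mean _ _ _ _ (fun w => f w * cinf +
    \sum_(k < m) c k * (f w * (away2 i j w <= k)%:R))); last first.
  move=> w; rewrite /wt mulrDr mulr_sumr; congr (_ + _).
  by apply: eq_bigr => k _; rewrite mulrCA.
rewrite meanD mean_sum meanZr /bnd mulrDr lerD2l mulr_sumr; apply: ler_sum => k _.
by rewrite meanZl mulrCA ler_wpM2l.
Qed.

(** Given [xi i], the total is 1 plus the part away from i plus the rest; given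
    nothing, the part away from i has the same law as given [xi i]. Both totals
    are thus compared with [away i] plus one, at the cost of the indicators near
    i. Removing the neighbours of the second index as well makes each such cost
    independent of the threshold event, which is the role of tau. *)
Lemma dissociated_stein_chen :
  `|E (fun w => (total w)%:R * g (total w)) -
    (\sum_i E (fun w => (xi i w)%:R)) * E (fun w => g (total w).+1)| <=
  (cinf + \sum_(k < m) c k * tau k) *
  (\sum_i \sum_(j | near i j && (i != j)) E (fun w => (xi i w)%:R * (xi j w)%:R) +
   \sum_i \sum_(j | near i j) E (fun w => (xi i w)%:R) * E (fun w => (xi j w)%:R)).
Proof.
rewrite -/bnd (@eq_mean _ _ _ _ (fun w => \sum_i (xi i w)%:R * g (total w))); last first.
  by move=> w; rewrite -mulr_suml -natr_sum.
rewrite mean_sum mulr_suml -sumrB (le_trans (ler_norm_sum _ _ _))//.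
rewrite -big_split mulr_sumr /=; apply: ler_sum => i _.
have E0 j : 0 <= E (fun w => (xi j w)%:R) by apply: mean_ge0.
have -> : E (fun w => (xi i w)%:R * g (total w)) -
    E (fun w => (xi i w)%:R) * E (fun w => g (total w).+1) =
    E (fun w => (xi i w)%:R * (g (total w) - g (away i w).+1)) +
    E (fun w => (xi i w)%:R) * E (fun w => g (away i w).+1 - g (total w).+1).
  rewrite meanB (@eq_mean _ _ _ (fun w => (xi i w)%:R * (g (total w) - g (away i w).+1))
    (fun w => (xi i w)%:R * g (total w) - (xi i w)%:R * g (away i w).+1)).
    by rewrite meanB (meanM_away i (fun k => g k.+1)); ring.
  by move=> w; rewrite mulrBr.
rewrite mulrDr (le_trans (ler_normD _ _))// lerD//.
  apply: le_trans (ler_norm_mean mu0 _) _.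
  apply: le_trans (_ : E (fun w => \sum_(j | near i j && (i != j))
      (xi i w)%:R * (xi j w)%:R * wt (away i w)) <= _).
    apply: ler_mean => // w; rewrite normrM ger0_norm//.
    case xw: (xi i w); last by rewrite mul0r; apply: sumr_ge0 => j _; rewrite !mul0r.
    rewrite mul1r; have tE : total w =
        ((away i w).+1 + \sum_(j | near i j && (i != j)) xi j w)%N.
      rewrite (split_total i) (bigD1 i) ?nearxx//= xw addnA addn1.
      by congr (_ + _)%N; apply: eq_bigl => j; rewrite eq_sym.
    apply: le_trans (g_osc (_ : (away i w < _)%N) (ltnSn _)) _; first by rewrite tE leq_addr.
    rewrite -/(wt _) tE natrD addrAC subrr add0r ger0_norm// mulrC natr_sum mulr_suml.
    by apply: ler_sum => j _; rewrite mul1r.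
  rewrite mean_sum mulrC mulr_suml; apply: ler_sum => j /andP[ij iNj].
  apply: (@mean_wt _ i j) => [w|k]; first by rewrite mulr_ge0.
  exact: tau_pair.
rewrite normrM ger0_norm// mulr_sumr.
have -> : \sum_(j | near i j) bnd * (E (fun w => (xi i w)%:R) * E (fun w => (xi j w)%:R)) =
    E (fun w => (xi i w)%:R) * \sum_(j | near i j) E (fun w => (xi j w)%:R) * bnd.
  by rewrite mulr_sumr; apply: eq_bigr => j _; ring.
rewrite ler_wpM2l//; apply: le_trans (ler_norm_mean mu0 _) _.
apply: le_trans (_ : E (fun w => \sum_(j | near i j) (xi j w)%:R * wt (away i w)) <= _).
  apply: ler_mean => // w; rewrite distrC.
  apply: le_trans (g_osc (_ : (away i w < _)%N) (ltnSn _)) _.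
    by rewrite ltnS (split_total i) leq_addr.
  rewrite -/(wt _) (split_total i) -addSn natrD addrAC subrr add0r ger0_norm//.
  by rewrite mulrC natr_sum mulr_suml.
rewrite mean_sum; apply: ler_sum => j ij.
by apply: (@mean_wt _ i j) => [w|k] //; exact: tau_single.
Qed.

End dissociated_stein_chen.

(** * Product laws on tuples and subsamples *)

Section tuple_laws.
Context {d} {T : measurableType d} {R : realType}.

Definition box k (A : 'I_k -> set T) : set (k.-tuple T) :=
  [set t | forall i, A i (tnth t i)].

Lemma measurable_box k (A : 'I_k -> set T) :
  (forall i, measurable (A i)) -> measurable (box A).
Proof.
move=> mA; have -> : box A = \bigcap_(i in [set: 'I_k])
    ((fun t : k.-tuple T => tnth t i) @^-1` A i).
  by apply/seteqP; split => t Bt i *; exact: Bt.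
apply: fin_bigcap_measurable => // i _; rewrite -[X in measurable X]setTI.
exact: measurable_tnth.
Qed.

Lemma tuple_measure_unique k (m1 m2 : probability (k.-tuple T) R) :
  (forall A : 'I_k -> set T, (forall i, measurable (A i)) -> m1 (box A) = m2 (box A)) ->
  forall D, measurable D -> m1 D = m2 D.
Proof.
move=> m12; pose G : set (set (k.-tuple T)) :=
  [set D | exists2 A : 'I_k -> set T, (forall i, measurable (A i)) & D = box A].
have boxT : setT = box (fun _ : 'I_k => [set: T]) by apply/seteqP; split.
apply: (measure_unique G (fun=> setT)).
- apply/seteqP; split; last first.
    apply: smallest_sub; first exact: sigma_algebra_measurable.
    by move=> D [A mA ->]; exact: measurable_box.
  apply: smallest_sub; first exact: smallest_sigma_algebra.
  move=> D; rewrite -bigcup_seq => -[i _ [A mA <-]]; rewrite setTI.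
  apply: sub_sigma_algebra; exists (fun j => if j == i then A else setT).
    by move=> j; case: ifP.
  apply/seteqP; split => t /=; first by move=> Ati j; case: eqP => [->|].
  by move=> /(_ i); rewrite eqxx.
- move=> D D' [A mA ->] [A' mA' ->]; exists (fun i => A i `&` A' i).
    by move=> i; exact: measurableI.
  apply/seteqP; split => t; first by move=> [At A't] i; split; [exact: At|exact: A't].
  by move=> AA; split => i; have [] := AA i.
- by move=> _; exists (fun=> setT).
- by apply/seteqP; split => // t _; exists 0%N.
- by move=> D [A mA ->]; exact: m12.
- by move=> _; exact: le_lt_trans (probability_le1 m1 measurableT) (ltry _).
Qed.

Definition cat_tuple2 i j (z : i.-tuple T * j.-tuple T) : (i + j).-tuple T :=
  [tuple of z.1 ++ z.2].

Lemma measurable_cat_tuple2 i j : measurable_fun setT (@cat_tuple2 i j).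
Proof.
apply/measurable_fun_tnthP => p.
case: (split_ordP p) => q ->.
  rewrite (_ : _ \o _ = (fun x => tnth x q) \o fst); last first.
    by apply/funext => z /=; rewrite tnth_lshift.
  by apply: measurableT_comp => //; exact: measurable_tnth.
rewrite (_ : _ \o _ = (fun x => tnth x q) \o snd); last first.
  by apply/funext => z /=; rewrite tnth_rshift.
by apply: measurableT_comp => //; exact: measurable_tnth.
Qed.

HB.instance Definition _ i j := isMeasurableFun.Build _ _ _ _ (@cat_tuple2 i j)
  (measurable_cat_tuple2 (i := i) (j := j)).

(** Both sides agree on boxes. This makes independence of blocks of coordinates,
    and Tonelli's theorem for the power law, instances of the product measure. *)
Lemma power_prob_cat (K : probability T R) i j (D : set ((i + j).-tuple T)) :
  measurable D ->
  (power_prob K i \x power_prob K j)%E (@cat_tuple2 i j @^-1` D) = power_prob K (i + j) D.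
Proof.
move=> mD; pose m := distribution (power_prob K i \x power_prob K j)%E (@cat_tuple2 i j).
rewrite -[LHS]/(m D); apply: tuple_measure_unique mD => A mA.
rewrite /m /distribution /pushforward power_prob_box// big_split_ord /=.
pose A1 p := A (lshift j p); pose A2 q := A (rshift i q).
have mA1 p : measurable (A1 p) := mA _; have mA2 q : measurable (A2 q) := mA _.
have mB1 := measurable_box mA1; have mB2 := measurable_box mA2.
rewrite -(power_prob_box K mA1) -(power_prob_box K mA2).
rewrite -[RHS](product_measure1E (power_prob K i) (power_prob K j) mB1 mB2).
congr (product_measure1 _ _ _); apply/seteqP; split => -[x y] /=.
  move=> Axy; split => q /=.
    by have := Axy (lshift j q); rewrite tnth_lshift.
  by have := Axy (rshift i q); rewrite tnth_rshift.
move=> [Ax Ay] p; case: (split_ordP p) => q ->.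
  by rewrite tnth_lshift; exact: Ax.
by rewrite tnth_rshift; exact: Ay.
Qed.

Definition coords i k (s : 'I_i -> 'I_k) (x : k.-tuple T) : i.-tuple T :=
  [tuple tnth x (s p) | p < i].

Lemma measurable_coords i k (s : 'I_i -> 'I_k) : measurable_fun setT (coords s).
Proof.
apply/measurable_fun_tnthP => p.
rewrite (_ : _ \o _ = fun x => tnth x (s p)); first exact: measurable_tnth.
by apply/funext => x /=; rewrite tnth_mktuple.
Qed.

End tuple_laws.

Lemma inj_cat n i j (s : 'I_i -> 'I_n) (t : 'I_j -> 'I_n) :
  injective s -> injective t -> (forall p q, s p != t q) ->
  exists u : 'I_(i + j) -> 'I_n,
    [/\ injective u, forall p, u (lshift j p) = s p & forall q, u (rshift i q) = t q].
Proof.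
move=> injs injt st.
pose u (p : 'I_(i + j)) := match fintype.split p with inl a => s a | inr b => t b end.
have ul a : u (lshift j a) = s a.
  by rewrite /u (_ : fintype.split _ = inl a)//; exact: (unsplitK (inl a)).
have ur b : u (rshift i b) = t b.
  by rewrite /u (_ : fintype.split _ = inr b)//; exact: (unsplitK (inr b)).
exists u; split=> // p p'.
case: (split_ordP p) => q ->; case: (split_ordP p') => q' ->; rewrite ?ul ?ur.
- by move=> /injs ->.
- by move/eqP; rewrite (negbTE (st _ _)).
- by move/esym/eqP; rewrite (negbTE (st _ _)).
- by move=> /injt ->.
Qed.

Section subsamples.
Context {d dO} {T : measurableType d} {O : measurableType dO} {R : realType}.
Variables (P : probability O R) (K : probability T R) (n : nat).
Variable X : 'I_n -> {RV P >-> T}.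

(** The points are chosen along a map s of indices rather than a set, because the
    kernel takes its arguments in some order. *)
Definition subsample k (s : 'I_k -> 'I_n) (w : O) : k.-tuple T :=
  [tuple X (s p) w | p < k].

Lemma measurable_subsample k (s : 'I_k -> 'I_n) : measurable_fun setT (subsample s).
Proof.
apply/measurable_fun_tnthP => p.
rewrite (_ : _ \o _ = X (s p)); first exact: measurable_funPT.
by apply/funext => w /=; rewrite tnth_mktuple.
Qed.

HB.instance Definition _ k (s : 'I_k -> 'I_n) :=
  isMeasurableFun.Build _ _ _ _ (subsample s) (measurable_subsample s).

Hypothesis HX : binomial_points K X.

(** Mutual independence is the agreement on boxes, hence on all measurable sets. *)
Lemma subsample_law k (s : 'I_k -> 'I_n) (D : set (k.-tuple T)) :
  injective s -> measurable D -> P (subsample s @^-1` D) = power_prob K k D.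
Proof.
move=> injs mD; rewrite -[LHS]/(distribution P (subsample s) D).
apply: tuple_measure_unique mD => A mA.
rewrite power_prob_box// /distribution /pushforward.
pose B i : set T := if [pick p | s p == i] is Some p then A p else setT.
have Bs p : B (s p) = A p.
  rewrite /B; case: pickP => [q /eqP /injs -> //|/(_ p)]; by rewrite eqxx.
have mB i : measurable (B i) by rewrite /B; case: pickP.
have [lawX indX] := HX.
transitivity (P (\bigcap_(i in [set` [set s p | p : 'I_k]%SET]) (X i @^-1` B i))).
  congr (P _); apply/seteqP; split => w /=.
    by move=> Aw _ /imsetP[p _ ->]; rewrite /preimage/= Bs; have := Aw p; rewrite tnth_mktuple.
  move=> Bw p; rewrite tnth_mktuple -Bs; apply: Bw.
  by apply/imsetP; exists p.
rewrite indX// big_imset /=; last by move=> ? ? _ _; exact: injs.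
by apply: eq_big => [p|p _]; rewrite ?inE// Bs -(lawX (s p)).
Qed.

Lemma subsample_pair_law i j (s : 'I_i -> 'I_n) (t : 'I_j -> 'I_n)
    (C : set (i.-tuple T * j.-tuple T)) :
  injective s -> injective t -> (forall p q, s p != t q) -> measurable C ->
  P [set w | C (subsample s w, subsample t w)] =
  (power_prob K i \x power_prob K j)%E C.
Proof.
move=> injs injt st mC.
have [u [inju ul ur]] := inj_cat injs injt st.
pose cut (x : (i + j).-tuple T) := (coords (@lshift i j) x, coords (@rshift i j) x).
have mcut : measurable_fun setT cut.
  by apply: measurable_fun_pair; exact: measurable_coords.
have mD : measurable (cut @^-1` C) by rewrite -[X in measurable X]setTI; exact: mcut.
have cut_sub w : cut (subsample u w) = (subsample s w, subsample t w).
  by congr pair; apply: eq_from_tnth => p; rewrite !tnth_mktuple ?ul ?ur.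
have cut_cat z : cut (cat_tuple2 z) = z.
  case: z => x y; congr pair; apply: eq_from_tnth => p; rewrite tnth_mktuple.
    by rewrite tnth_lshift.
  by rewrite tnth_rshift.
transitivity (P (subsample u @^-1` (cut @^-1` C))).
  by congr (P _); apply/seteqP; split => w /=; rewrite /preimage /= cut_sub.
rewrite subsample_law// -power_prob_cat//; congr (product_measure1 _ _ _).
by apply/seteqP; split => z /=; rewrite /preimage /= cut_cat.
Qed.

Lemma subsample_independent i j (s : 'I_i -> 'I_n) (t : 'I_j -> 'I_n)
    (A : set (i.-tuple T)) (B : set (j.-tuple T)) :
  injective s -> injective t -> (forall p q, s p != t q) ->
  measurable A -> measurable B ->
  P (subsample s @^-1` A `&` subsample t @^-1` B) =
  (P (subsample s @^-1` A) * P (subsample t @^-1` B))%E.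
Proof.
move=> injs injt st mA mB.
rewrite -[LHS]/(P [set w | (A `*` B) (subsample s w, subsample t w)]).
rewrite subsample_pair_law//; last exact: measurableX.
by rewrite product_measure1E// !subsample_law.
Qed.

End subsamples.

(** * U-statistics as sums over index sets *)

Section hits.
Context {T O : Type} {l : nat}.
Variable h : l.-tuple T -> bool.
Hypothesis hsym : symmetric_kernel h.

(** The kernel evaluated at the points with indices in V, for V of cardinality l,
    and false for every other V. *)
Definition hit n (X : 'I_n -> O -> T) (V : {set 'I_n}) (w : O) : bool :=
  [exists s : {ffun 'I_l -> 'I_n},
     [&& injectiveb s, [set s i | i : 'I_l]%SET == V & h [tuple X (s i) w | i < l]]].

Lemma kernel_same_image n (X : 'I_n -> O -> T) (s t : 'I_l -> 'I_n) w :
  injective s -> injective t ->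
  [set s i | i : 'I_l]%SET = [set t i | i : 'I_l]%SET ->
  h [tuple X (s i) w | i < l] = h [tuple X (t i) w | i < l].
Proof.
move=> injs injt st.
have ex i : exists j, t j == s i.
  have : s i \in [set t i | i : 'I_l]%SET by rewrite -st imset_f.
  by case/imsetP => j _ ->; exists j.
pose p i := xchoose (ex i).
have pE i : t (p i) = s i by apply/eqP; exact: (xchooseP (ex i)).
have injp : injective p by move=> i j /(congr1 t); rewrite !pE => /injs.
rewrite -(hsym (perm injp) [tuple X (t i) w | i < l]).
congr h; apply: eq_from_tnth => i; by rewrite !tnth_mktuple permE pE.
Qed.

Lemma hitE n (X : 'I_n -> O -> T) (s : 'I_l -> 'I_n) (V : {set 'I_n}) w :
  injective s -> [set s i | i : 'I_l]%SET = V -> hit X V w = h [tuple X (s i) w | i < l].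
Proof.
move=> injs sV; apply/existsP/idP.
  move=> [t /and3P[/injectiveP injt /eqP tV ht]].
  by rewrite -(kernel_same_image X w injt injs)// tV sV.
move=> hs; exists (finfun s); apply/and3P; split.
- by apply/injectiveP => i j; rewrite !ffunE => /injs.
- by rewrite -sV; apply/eqP; apply: eq_imset => i; rewrite ffunE.
- by rewrite (_ : [tuple _ | _ < _] = [tuple X (s i) w | i < l])//;
    apply: eq_from_tnth => i; rewrite !tnth_mktuple ffunE.
Qed.

Lemma hit_card n (X : 'I_n -> O -> T) (V : {set 'I_n}) w : hit X V w -> #|V| = l.
Proof.
move=> /existsP[s /and3P[/injectiveP injs /eqP <- _]].
by rewrite card_imset// card_ord.
Qed.

(** Each index set of cardinality l is the image of [l`!] injections, on which the
    symmetric kernel takes the same value. *)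
Lemma ustat_hits n (X : 'I_n -> O -> T) w : ustat h X w = (\sum_V hit X V w)%N.
Proof.
apply/eqP; rewrite -(eqn_pmul2l (fact_gt0 l)) (factM_ustat hsym); apply/eqP.
rewrite (partition_big (fun s : {ffun 'I_l -> 'I_n} => [set s i | i : 'I_l]%SET) predT) //=.
rewrite big_distrr /=; apply: eq_bigr => V _.
rewrite (eq_bigr (fun=> hit X V w : nat)); last first.
  by move=> s /andP[/injectiveP injs /eqP sV]; rewrite (hitE _ _ injs sV).
rewrite sum_nat_const; case hV : (hit X V w); last by rewrite !muln0.
rewrite !muln1; have cV : #|mem V| = l by exact: hit_card hV.
have := @card_inj_ffuns_on 'I_l 'I_n (mem V); rewrite card_ord cV ffactnn => <-.
apply: eq_card => s; rewrite [RHS]inE [RHS]andbC -[LHS]/(injectiveb s && _).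
apply: andb_id2l => /injectiveP injs; apply/eqP/ffun_onP => [<- i|sA]; first exact: imset_f.
apply/eqP; rewrite eqEcard card_imset // card_ord (hit_card hV) leqnn andbT.
by apply/fintype.subsetP => _ /imsetP[i _ ->]; exact: sA.
Qed.

Lemma hit_comp n k (X : 'I_n -> O -> T) (u : 'I_k -> 'I_n) (V : {set 'I_k}) w :
  injective u -> hit (fun i => X (u i)) V w = hit X (u @: V)%SET w.
Proof.
move=> inju; have imu (s : 'I_l -> 'I_k) :
    [set u (s i) | i : 'I_l]%SET = (u @: [set s i | i : 'I_l])%SET.
  by rewrite -imset_comp.
have [Vl|Vl] := eqVneq #|V| l; last first.
  apply/idP/idP => /hit_card; first by move/eqP; rewrite (negbTE Vl).
  by rewrite card_imset// => /eqP; rewrite (negbTE Vl).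
pose s (i : 'I_l) := enum_val (cast_ord (esym Vl) i).
have injs : injective s by move=> i j /enum_val_inj /cast_ord_inj.
have sV : [set s i | i : 'I_l]%SET = V.
  apply/eqP; rewrite eqEcard card_imset// card_ord Vl leqnn andbT.
  by apply/fintype.subsetP => _ /imsetP[i _ ->]; exact: enum_valP.
rewrite (hitE _ _ injs sV) (@hitE _ X (u \o s))//; first exact: inj_comp.
by rewrite -sV -imu.
Qed.

Lemma ustat_comp n k (X : 'I_n -> O -> T) (u : 'I_k -> 'I_n) w : injective u ->
  ustat h (fun i => X (u i)) w = (\sum_(V : {set 'I_n} | V \subset [set u i | i : 'I_k]%SET) hit X V w)%N.
Proof.
move=> inju; rewrite ustat_hits (eq_bigr (fun V : {set 'I_k} => hit X (u @: V)%SET w : nat)).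
  rewrite -(@big_imset _ _ addn _ _ (fun V : {set 'I_k} => u @: V)%SET predT
    (fun V => hit X V w : nat)) /=; last by move=> A B _ _; exact: imset_inj.
  apply: eq_bigl => V; apply/imsetP/idP => [[U _ ->]|Vu].
    by apply/fintype.subsetP => _ /imsetP[i _ ->]; exact: imset_f.
  exists (u @^-1: V)%SET => //; apply/setP => x; apply/idP/imsetP => [xV|[y + ->]].
    by have /imsetP[y _ xy] := fintype.subsetP Vu x xV; exists y => //; rewrite inE -xy.
  by rewrite inE.
by move=> V _; rewrite hit_comp.
Qed.

End hits.

(** * Two overlapping blocks of points *)

Section bool_integrals.
Context {d} {T : measurableType d} {R : realType}.

Lemma measurable_pred (b : T -> bool) :
  measurable_fun setT b -> measurable [set x | b x].
Proof.
move=> mb; rewrite -[X in measurable X]setTI.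
rewrite (_ : [set x | b x] = b @^-1` [set true]); first exact: mb.
by apply/seteqP; split.
Qed.

Lemma integral_bool (m : probability T R) (b : T -> bool) :
  measurable [set x | b x] -> (\int[m]_x ((b x)%:R)%:E = m [set x | b x])%E.
Proof.
move=> mb; rewrite -[X in _ = m X]setIT.
rewrite -integral_indic//; apply: eq_integral => x _.
by rewrite indicE; case: (boolP (b x)) => bx; [rewrite mem_set|rewrite memNset//; exact/negP].
Qed.

Lemma Rintegral_bool (m : probability T R) (b : T -> bool) :
  measurable [set x | b x] -> \int[m]_x (b x)%:R = fine (m [set x | b x]).
Proof. by move=> mb; rewrite /Rintegral integral_bool. Qed.

End bool_integrals.

Section overlap_probability.
Context {d dO} {T : measurableType d} {O : measurableType dO} {R : realType}.
Variables (P : probability O R) (K : probability T R) (n : nat).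
Variable X : 'I_n -> {RV P >-> T}.
Hypothesis HX : binomial_points K X.

Lemma measurable_cat_l i j (h : (i + j).-tuple T -> bool) (x : i.-tuple T) :
  measurable_fun setT h -> measurable_fun setT (fun y : j.-tuple T => h [tuple of x ++ y]).
Proof.
move=> mh; apply: (measurableT_comp mh).
rewrite (_ : (fun y => _) = (@cat_tuple2 _ T i j) \o (pair x))//.
by apply: measurableT_comp; [exact: measurable_cat_tuple2|exact: measurable_pair1].
Qed.

(** Given the i common points c, the two remaining blocks are independent with the
    same law, so the conditional probability is a square. *)
Lemma overlap_pairE l (h : l.-tuple T -> bool) i j (e : (i + j)%N = l)
    (c : 'I_i -> 'I_n) (a b : 'I_j -> 'I_n) :
  measurable_fun setT h ->
  injective c -> injective a -> injective b ->
  (forall p q, c p != a q) -> (forall p q, c p != b q) -> (forall p q, a p != b q) ->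
  fine (P [set w | h (tcast e [tuple of subsample X c w ++ subsample X a w]) &&
                   h (tcast e [tuple of subsample X c w ++ subsample X b w])]) =
  \int[power_prob K i]_x
    (\int[power_prob K j]_y (h (tcast e [tuple of x ++ y]))%:R) ^+ 2.
Proof.
case: l / e h => h mh injc inja injb ca cb ab.
have [u [inju ul ur]] := inj_cat inja injb ab.
have cu p q : c p != u q by case: (split_ordP q) => r ->; rewrite ?ul ?ur.
pose lft := @coords _ T _ _ (@lshift j j); pose rgt := @coords _ T _ _ (@rshift j j).
pose C : set (i.-tuple T * (j + j).-tuple T) :=
  [set z | h (cat_tuple2 (z.1, lft z.2)) && h (cat_tuple2 (z.1, rgt z.2))].
have mcat (f : (j + j).-tuple T -> j.-tuple T) : measurable_fun setT f ->
    measurable_fun setT (fun z : i.-tuple T * (j + j).-tuple T => h (cat_tuple2 (z.1, f z.2))).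
  move=> mf; apply: (measurableT_comp mh).
  apply: (measurableT_comp (@measurable_cat_tuple2 _ T i j)).
  by apply: measurable_fun_pair => //; exact: measurableT_comp.
have mC : measurable C.
  by apply: measurable_pred; apply: measurable_and; apply: mcat; exact: measurable_coords.
transitivity (fine (P [set w | C (subsample X c w, subsample X u w)])).
  have lE w : lft (subsample X u w) = subsample X a w.
    by apply: eq_from_tnth => p; rewrite !tnth_mktuple ul.
  have rE w : rgt (subsample X u w) = subsample X b w.
    by apply: eq_from_tnth => p; rewrite !tnth_mktuple ur.
  by congr (fine (P _)); apply/seteqP; split => w /=; rewrite /C /= lE rE.
rewrite (subsample_pair_law HX)// /Rintegral; congr fine.
apply: eq_integral => x _ /=.
pose A := [set y : j.-tuple T | h [tuple of x ++ y]].
have mA : measurable A by apply: measurable_pred; exact: measurable_cat_l.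
rewrite integral_bool//.
have -> : xsection C x = [set y | (A `*` A) (lft y, rgt y)].
  by apply/seteqP; split => y; rewrite /xsection /= inE /C /= => /andP.
pose D := [set y : (j + j).-tuple T | (A `*` A) (lft y, rgt y)].
have mD : measurable D.
  rewrite -[X in measurable X]setTI; apply: (measurable_fun_pair _ _ _ (measurableX mA mA)) => //;
    exact: measurable_coords.
rewrite -(power_prob_cat _ mD).
rewrite (_ : _ @^-1` D = A `*` A); last first.
  have lE y : lft (cat_tuple2 y) = y.1.
    by apply: eq_from_tnth => p; rewrite tnth_mktuple tnth_lshift.
  have rE y : rgt (cat_tuple2 y) = y.2.
    by apply: eq_from_tnth => p; rewrite tnth_mktuple tnth_rshift.
  by apply/seteqP; split => y; rewrite /D /preimage /= lE rE.
rewrite product_measure1E// expr2 EFinM fineK// fin_num_measure//.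
Qed.

End overlap_probability.

(** * Finite-valued and Poisson variables *)

Section finite_valued.
Context {d} {O : measurableType d} {R : realType} {F : finType}.
Variables (P : probability O R) (Y : O -> F).
Hypothesis mY : forall y, measurable (Y @^-1` [set y]).

(** The law of a finite-valued variable as a weight function, which turns
    expectations into the finite sums [mean]. *)
Definition law y : R := fine (P (Y @^-1` [set y])).

Lemma law_ge0 y : 0 <= law y.
Proof. by rewrite fine_ge0. Qed.

Let indic_sum (G : F -> R) w :
  (G (Y w))%:E = (\sum_y (G y)%:E * (\1_(Y @^-1` [set y]) w)%:E)%E.
Proof.
rewrite (bigD1 (Y w))//= indicE mem_set// mule1 big1 ?adde0// => y yw.
by rewrite indicE memNset ?mule0// /preimage /= => wy; rewrite wy eqxx in yw.
Qed.

Let int_indic (G : F -> R) y :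
  P.-integrable setT (fun w => (G y)%:E * (\1_(Y @^-1` [set y]) w)%:E)%E.
Proof. by apply: integrableZl => //; exact: integrable_indic. Qed.

Lemma integrable_finite (G : F -> R) : P.-integrable setT (fun w => (G (Y w))%:E).
Proof.
rewrite (_ : (fun w => _) = (fun w => \sum_y (G y)%:E * (\1_(Y @^-1` [set y]) w)%:E)%E).
  by apply: integrable_sum => // y _; exact: int_indic.
by apply/funext => w; rewrite indic_sum.
Qed.

Lemma integral_finite (G : F -> R) :
  (\int[P]_w (G (Y w))%:E = (mean law G)%:E)%E.
Proof.
under eq_integral do rewrite indic_sum.
rewrite integral_sum// -sumEFin.
apply: eq_bigr => y _; rewrite integralZl//; last exact: integrable_indic.
by rewrite integral_indic// setIT muleC EFinM fineK// fin_num_measure.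
Qed.

Lemma measurable_finite (b : pred F) : measurable [set w | b (Y w)].
Proof.
rewrite (_ : [set w | _] = \bigcup_(y in [set y | b y]) (Y @^-1` [set y])).
  by apply: fin_bigcup_measurable => //; exact: finite_finset.
apply/seteqP; split => w; first by move=> bw; exists (Y w).
by move=> [y /= byy ->].
Qed.

Lemma prob_finite (b : pred F) :
  P [set w | b (Y w)] = (mean law (fun y => (b y)%:R))%:E.
Proof.
by rewrite -integral_finite (integral_bool _ (measurable_finite b)).
Qed.

Lemma law_sum1 : \sum_y law y = 1.
Proof.
have := prob_finite predT; rewrite (_ : [set w | _] = setT); last by apply/seteqP.
rewrite probability_setT => -[] ->; apply: eq_bigr => y _.
by rewrite mulr1.
Qed.

End finite_valued.

Lemma measurable_bool_family d (O : measurableType d) (I : finType)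
    (b : I -> O -> bool) (Q : pred {ffun I -> bool}) :
  (forall i, measurable_fun setT (b i)) ->
  measurable [set w | Q [ffun i => b i w]].
Proof.
move=> mb; apply: (@measurable_finite _ O _ (fun w => [ffun i => b i w])) => y.
rewrite (_ : _ @^-1` _ = \bigcap_(i in [set: I]) (b i @^-1` [set y i])).
  apply: fin_bigcap_measurable; first exact: finite_finset.
  by move=> i _; rewrite -[X in measurable X]setTI; exact: mb.
apply/seteqP; split => w /=.
  by rewrite /preimage /= => <- i _ /=; rewrite ffunE.
by move=> bw; apply/ffunP => i; rewrite ffunE; exact: bw.
Qed.

Section poisson_variable_means.
Context {d} {O : measurableType d} {R : realType}.
Variables (Q : probability O R) (Z : {RV Q >-> nat}) (x : R).
Hypothesis x0 : 0 < x.
Hypothesis HZ : poisson_variable Z x.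

Let QZ k : fine (Q (Z @^-1` [set k])) = pois x k.
Proof. by rewrite HZ /= pois_pmfE. Qed.

Let mZ (A : set nat) : measurable (Z @^-1` A).
Proof. by rewrite -[X in measurable X]setTI; exact: (measurable_funPT Z). Qed.

Let Zk k (w : O) : 'I_k.+1 := inord (minn (Z w) k).

Let mZk k y : measurable (Zk k @^-1` [set y]).
Proof. exact: (mZ (fun j => (inord (minn j k) : 'I_k.+1) = y)). Qed.

Let lawZk k (y : 'I_k.+1) :
  law Q (Zk k) y = if (y < k)%N then pois x y else pois_ge x k.
Proof.
have lt (z : 'I_k.+1) : (z < k)%N -> law Q (Zk k) z = pois x z.
  move=> zk; rewrite -QZ /law; congr (fine (Q _)); apply/seteqP; split => w.
    rewrite /preimage /Zk /= => wz; have := congr1 val wz.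
    by rewrite /= inordK ?ltnS ?geq_minr//; move: zk; lia.
  rewrite /preimage /= => zw; apply: val_inj; rewrite /= inordK ?ltnS ?geq_minr// zw.
  by move: zk; lia.
case: ifP => [/lt //|yk].
have -> : y = ord_max by apply: val_inj => /=; have := ltn_ord y; lia.
have := law_sum1 Q (@mZk k); rewrite big_ord_recr /= => e.
rewrite /pois_ge -e addrAC [X in X - _](_ : _ = pois_lt x k) ?subrr ?add0r//.
by apply: eq_bigr => i _; rewrite lt //= ltn_ord.
Qed.

Lemma mean_truncated (f : nat -> R) k :
  (\int[Q]_w (f (minn (Z w) k))%:E =
   (\sum_(j < k) pois x j * f j + f k * pois_ge x k)%:E)%E.
Proof.
have -> : (\int[Q]_w (f (minn (Z w) k))%:E = \int[Q]_w (f (Zk k w))%:E)%E.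
  by apply: eq_integral => w _; rewrite /Zk inordK// ltnS geq_minr.
rewrite (integral_finite Q (@mZk k) (fun y : 'I_k.+1 => f y)); congr (_%:E).
rewrite /mean big_ord_recr /= lawZk ltnn mulrC; congr (_ + _).
by apply: eq_bigr => i _; rewrite lawZk /= ltn_ord.
Qed.

Lemma integrable_truncated (f : nat -> R) k :
  Q.-integrable setT (fun w => (f (minn (Z w) k))%:E).
Proof.
have -> : (fun w => (f (minn (Z w) k))%:E) = (fun w => (f (Zk k w))%:E).
  by apply/funext => w; rewrite /Zk inordK// ltnS geq_minr.
exact: (integrable_finite Q (@mZk k) (fun y : 'I_k.+1 => f y)).
Qed.

Lemma prob_le_poisson v : fine (Q [set w | (Z w <= v)%N]) = pois_lt x v.+1.
Proof.
have mE : measurable [set w | (Z w <= v)%N] by exact: (mZ (fun j => (j <= v)%N)).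
rewrite -(integral_bool Q mE).
have := mean_truncated (fun j => (j <= v)%:R) v.+1.
rewrite ltnn mul0r addr0 => e.
rewrite (_ : (\int[Q]_w _ = \int[Q]_w ((minn (Z w) v.+1 <= v)%:R)%:E)%E).
  by rewrite e /=; apply: eq_bigr => j _; rewrite -ltnS ltn_ord mulr1.
by apply: eq_integral => w _; congr (_%:R%:E); congr nat_of_bool; lia.
Qed.

(** The probability of A is that of its part below i, plus something between 0
    and the tail from i on. *)
Lemma prob_poisson_between (A : set nat) i :
  \sum_(j < i) pois x j * (`[< A j >])%:R <= fine (Q (Z @^-1` A)) <=
  \sum_(j < i) pois x j * (`[< A j >])%:R + pois_ge x i.
Proof.
have mb (b : pred nat) : measurable [set w | b (Z w)] by exact: (mZ b).
pose lo j := `[< A j >] && (j < i)%N; pose up j := `[< A j >] || (i <= j)%N.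
have Elo : fine (Q [set w | lo (Z w)]) = \sum_(j < i) pois x j * (`[< A j >])%:R.
  rewrite -(integral_bool Q (mb lo)).
  have := mean_truncated (fun j => (lo j)%:R) i; rewrite /lo ltnn andbF mul0r addr0 => e.
  rewrite (_ : (\int[Q]_w _ = \int[Q]_w ((lo (minn (Z w) i))%:R)%:E)%E).
    by rewrite e /=; apply: eq_bigr => j _; rewrite ltn_ord andbT.
  apply: eq_integral => w _; congr (_%:R%:E); congr nat_of_bool; rewrite /lo.
  by rewrite /minn; case: ifP => [->|wi]; rewrite ?ltnn ?wi ?andbF.
have Eup : fine (Q [set w | up (Z w)]) =
    \sum_(j < i) pois x j * (`[< A j >])%:R + pois_ge x i.
  rewrite -(integral_bool Q (mb up)).
  have := mean_truncated (fun j => (up j)%:R) i; rewrite /up leqnn orbT mul1r => e.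
  rewrite (_ : (\int[Q]_w _ = \int[Q]_w ((up (minn (Z w) i))%:R)%:E)%E).
    rewrite e /=; congr (_ + _); apply: eq_bigr => j _.
    by rewrite leqNgt ltn_ord orbF.
  apply: eq_integral => w _; congr (_%:R%:E); congr nat_of_bool; rewrite /up.
  by rewrite /minn; case: ifP => [//|wi]; rewrite leqnn leqNgt wi !orbT.
rewrite -Eup -Elo; apply/andP; split; apply: fine_le; rewrite ?fin_num_measure//;
  apply: le_measure; rewrite ?inE//.
- by move=> w /=; rewrite /lo => /andP[/asboolP].
- by move=> w /= Aw; rewrite /up; apply/orP; left; apply/asboolP.
Qed.

(** By monotone convergence along the values of Z. The partial sums telescope
    because [j%:R * pois x j] is x times the preceding weight. *)
Lemma mean_poisson_excess k :
  (\int[Q]_w ((Z w - k)%N%:R)%:E = (pois_above x k)%:E)%E.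
Proof.
have UZ : \bigcup_j (Z @^-1` [set j]) = setT.
  by apply/seteqP; split => // w _; exists (Z w).
have tZ : trivIset setT (fun j => Z @^-1` [set j]).
  by apply: trivIset_preimage1.
have mF (D : set O) : measurable_fun D (EFin \o (fun w => (Z w - k)%N%:R : R)).
  apply: measurable_funTS; apply/measurable_EFinP.
  exact: (@measurableT_comp _ _ _ _ _ _ (fun j : nat => ((j - k)%N%:R : R)) _ Z).
rewrite -{1}UZ ge0_integral_bigcup//.
transitivity (\sum_(j <oo) ((j - k)%N%:R * pois x j)%:E)%E.
  apply: eq_eseriesr => j _.
  rewrite (eq_integral (fun=> ((j - k)%N%:R : R)%:E)); last first.
    by move=> w; rewrite inE /preimage /= => ->.
  by rewrite integral_cst// EFinM -QZ fineK// fin_num_measure.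
pose s N : R := \sum_(0 <= j < N) (j - k)%N%:R * pois x j.
have sE N : s (k + N).+1 = x * pois_lt x (k + N) - k%:R * pois_lt x (k + N).+1 + pois_below x k.
  elim: N => [|N IH].
    rewrite addn0 /s big1_seq; last first.
      by move=> j /andP[_]; rewrite mem_index_iota ltnS => /andP[_] /eqP ->; rewrite mul0r.
    by rewrite pois_ltS /pois_below; ring.
  rewrite addnS /s big_nat_recr//= -/(s _) IH (pois_ltS x (k + N).+1) (pois_ltS x (k + N)).
  have := poisS x (k + N); rewrite (_ : ((k + N).+1 - k)%N = N.+1); last by lia.
  rewrite -!natr1 natrD => e.
  have -> : x * (pois_lt x (k + N) + pois x (k + N)) =
    x * pois_lt x (k + N) + (k%:R + N%:R + 1) * pois x (k + N).+1 by rewrite e mulrDr.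
  by move: (pois_below x k) => b; ring.
apply/cvg_lim => //.
rewrite -(cvg_shiftn (k.+1)).
have -> : (fun N => (\sum_(0 <= j < N + k.+1) ((j - k)%N%:R * pois x j)%:E)%E) =
    (fun N => (s (k + N).+1)%:E).
  by apply/funext => N; rewrite sumEFin addnS addnC.
apply/cvg_EFin; first by apply: nearW.
have -> : fine \o (fun N => (s (k + N).+1)%:E) =
    (fun N => x * pois_lt x (k + N) - k%:R * pois_lt x (k + N).+1 + pois_below x k).
  by apply/funext => N /=; rewrite sE.
have -> : pois_above x k = x * 1 - k%:R * 1 + pois_below x k.
  by have := pois_aboveB x k => /eqP; rewrite subr_eq => /eqP ->; rewrite !mulr1.
apply: cvgD; last exact: cvg_cst.
have cl c : pois_lt x (c + N)%N @[N --> \oo] --> (1 : R).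
  have := @pois_lt_cvg R x; rewrite -(cvg_shiftn c).
  by under eq_fun do rewrite addnC.
apply: cvgB; apply: cvgMr; [exact: cl|].
by have := cl k.+1; under eq_fun do rewrite addSn.
Qed.

(** Truncating Z at k leaves the explicit sum, and changes f Z by at most the
    excess of Z over k, whose mean is [pois_above x k]. *)
Lemma poisson_lipschitz_mean (f : nat -> R) :
  (forall a b : nat, `|f a - f b| <= `|a%:R - b%:R|) ->
  exists2 m : R, (\int[Q]_w (f (Z w))%:E = m%:E)%E &
  forall k, `|m - \sum_(j < k) pois x j * f j - f k * pois_ge x k| <= pois_above x k.
Proof.
move=> lf; pose e k w := f (Z w) - f (minn (Z w) k).
have mfun (F : nat -> R) : measurable_fun setT (fun w => F (Z w)).
  exact: (@measurableT_comp _ _ _ _ _ _ F _ Z).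
have eb k w : `|e k w| <= (Z w - k)%N%:R.
  apply: le_trans (lf _ _) _; rewrite -natrB ?geq_minl// ger0_norm// ler_nat; lia.
have mexc k : measurable_fun setT (EFin \o (fun w => (Z w - k)%N%:R : R)).
  by apply/measurable_EFinP; exact: (mfun (fun j => (j - k)%N%:R)).
have iexc k : Q.-integrable setT (EFin \o (fun w => (Z w - k)%N%:R : R)).
  apply/integrableP; split; first exact: mexc.
  under eq_integral do rewrite gee0_abs ?lee_fin//.
  by rewrite mean_poisson_excess ltry.
have me k : measurable_fun setT (EFin \o e k).
  apply/measurable_EFinP.
  exact: (mfun (fun j => f j - f (minn j k))).
have ie k : Q.-integrable setT (fun w => (e k w)%:E).
  apply: (le_integrable _ _ _ (iexc k)) => //; first exact: me.
  by move=> w _ /=; rewrite lee_fin (le_trans (eb k w))// ler_norm.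
have fE k : (\int[Q]_w (f (Z w))%:E =
    (\sum_(j < k) pois x j * f j + f k * pois_ge x k)%:E + \int[Q]_w (e k w)%:E)%E.
  have ic := integrable_truncated f k; rewrite -mean_truncated -integralD_EFin//; last exact: ie.
  by apply: eq_integral => w _; rewrite -EFinD /e addrC subrK.
have fe : forall j, (\int[Q]_w (e j w)%:E)%E \is a fin_num.
  by move=> j; exact: integrable_fin_num.
exists (fine (\int[Q]_w (f (Z w))%:E)%E).
  by rewrite fineK// (fE 0%N) fin_numD fe.
move=> k; rewrite -lee_fin -mean_poisson_excess.
rewrite (_ : _ - _ - _ = fine (\int[Q]_w (e k w)%:E)%E); last first.
  by rewrite (fE k) fineD//=; ring.
rewrite -abse_EFin fineK//.
apply: le_trans (le_abse_integral _ measurableT (me k)) _.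
apply: ge0_le_integral => //.
- by apply: measurableT_comp.
- exact: mexc.
by move=> w _; rewrite lee_fin.
Qed.

End poisson_variable_means.

(** * Counting index sets *)

Section counting.
Variables (n l : nat).
Implicit Types (V U A : {set 'I_n}).

Lemma card_lsets : #|[set V : {set 'I_n} | #|V| == l]%SET| = 'C(n, l).
Proof. by rewrite card_draws card_ord. Qed.

(** Such a U is determined by its part outside V. *)
Lemma card_fixed_trace V A :
  (#|[set U : {set 'I_n} | (#|U| == l) && (V :&: U == A)]%SET| <= 'C(n - #|V|, l - #|A|))%N.
Proof.
have <- : #|~: V| = (n - #|V|)%N by have := cardsC V; rewrite card_ord; lia.
rewrite -cards_draws.
rewrite -(card_in_imset (f := fun U : {set 'I_n} => (U :\: V)%SET)); last first.
  move=> U U'; rewrite !inE => /andP[_ /eqP UA] /andP[_ /eqP U'A] UU'.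
  by rewrite -(setID U V) -(setID U' V) UU' ![(_ :&: V)%SET]finset.setIC UA U'A.
apply: subset_leq_card; apply/fintype.subsetP => _ /imsetP[U + ->].
rewrite !inE => /andP[/eqP Ul /eqP UA]; apply/andP; split.
  by apply/fintype.subsetP => x; rewrite !inE => /andP[].
by rewrite cardsD Ul finset.setIC UA.
Qed.

Lemma card_lsets_through (x : 'I_n) : (0 < l)%N ->
  #|[set U : {set 'I_n} | (#|U| == l) && (x \in U)]%SET| = 'C(n.-1, l.-1).
Proof.
move=> l0; have n0 : (0 < n)%N by apply: leq_ltn_trans (ltn_ord x).
have := card_lsets; rewrite -(cardsID [set U : {set 'I_n} | x \in U]%SET).
have -> : #|([set V : {set 'I_n} | #|V| == l]%SET :\: [set U : {set 'I_n} | x \in U]%SET)%SET| = 'C(n.-1, l).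
  have -> : n.-1 = #|[set~ x]%SET| by rewrite cardsC1 card_ord.
  rewrite -cards_draws; apply: eq_card => U; rewrite !inE; congr andb.
  apply/idP/fintype.subsetP => [xU y yU|xU]; rewrite ?inE.
    by apply: contraNneq xU => <-.
  by apply/negP => /xU; rewrite !inE eqxx.
have -> : ([set V : {set 'I_n} | #|V| == l]%SET :&: [set U : {set 'I_n} | x \in U]%SET)%SET =
    [set U : {set 'I_n} | (#|U| == l) && (x \in U)]%SET by apply/setP => U; rewrite !inE.
have := binS n.-1 l.-1; rewrite (prednK n0) (prednK l0) => -> /eqP.
by rewrite addnC eqn_add2l => /eqP.
Qed.

(** Union bound over the elements of V: each lies in a fraction l / n of the sets. *)
Lemma card_meeting V : (0 < l)%N -> #|V| = l ->
  (n * #|[set U : {set 'I_n} | (#|U| == l) && ~~ [disjoint V & U]]%SET| <= l * l * 'C(n, l))%N.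
Proof.
move=> l0 Vl.
have union : (#|[set U : {set 'I_n} | (#|U| == l) && ~~ [disjoint V & U]]%SET| <=
    \sum_(x in V) #|[set U : {set 'I_n} | (#|U| == l) && (x \in U)]%SET|)%N.
  rewrite -sum1_card (eq_bigr (fun x => \sum_(U : {set 'I_n} | (#|U| == l) && (x \in U)) 1)%N).
    rewrite (exchange_big_dep (fun U : {set 'I_n} => #|U| == l)) /=; last first.
      by move=> x U _ /andP[].
    rewrite [X in (_ <= X)%N]big_mkcond [X in (X <= _)%N]big_mkcond /=; apply: leq_sum => U _.
    rewrite inE; case: eqP => //= Ul; case: ifP => // /pred0Pn[x /andP[/= xV xU]].
    by rewrite (bigD1 x) ?xV//= leq_addr.
  by move=> x _; rewrite sum1dep_card.
rewrite (eq_bigr (fun=> 'C(n.-1, l.-1))) ?sum_nat_const ?Vl in union; last first.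
  by move=> x _; rewrite card_lsets_through.
apply: leq_trans (leq_mul (leqnn n) union) _.
by rewrite mulnCA mul_bin_diag (prednK l0) mulnA.
Qed.

Lemma ffactnD a b : n ^_ (a + b) = (n ^_ a * (n - a) ^_ b)%N.
Proof.
elim: b => [|b IH]; first by rewrite addn0 muln1.
by rewrite addnS !ffactnSr IH mulnA subnDA.
Qed.

Lemma lsets_pairs_le i : (i <= l)%N -> (l <= n)%N ->
  ('C(n, l) * 'C(n - l, l - i) * l`! <= n ^_ (2 * l - i))%N.
Proof.
move=> il ln; rewrite mulnAC bin_ffact.
have -> : (2 * l - i)%N = (l + (l - i))%N by lia.
by rewrite ffactnD leq_mul2l; apply/orP; right; rewrite -bin_ffact leq_pmulr ?fact_gt0.
Qed.

End counting.

(** * Laws of the index sets that are hit *)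

Section hit_events.
Context {d dO} {T : measurableType d} {O : measurableType dO} {R : realType}.
Variables (P : probability O R) (K : probability T R) (n l : nat).
Variables (X : 'I_n -> {RV P >-> T}) (h : l.-tuple T -> bool).
Hypothesis mh : measurable_fun setT h.
Hypothesis hsym : symmetric_kernel h.

Let Xf (i : 'I_n) : O -> T := X i.

Let canon k (i : 'I_k) (x : k.-tuple T) : T := tnth x i.

Lemma enum_set m (V : {set 'I_m}) k : #|V| = k ->
  exists2 s : 'I_k -> 'I_m, injective s & [set s i | i : 'I_k]%SET = V.
Proof.
move=> Vk; exists (fun i => enum_val (cast_ord (esym Vk) i)).
  by move=> i j /enum_val_inj /cast_ord_inj.
apply/eqP; rewrite eqEcard card_imset; last by move=> i j /enum_val_inj /cast_ord_inj.
apply/andP; split; last by rewrite card_ord Vk.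
by apply/fintype.subsetP => _ /imsetP[i _ ->]; exact: enum_valP.
Qed.

Lemma measurable_hit k d' (O' : measurableType d') (Y : 'I_k -> O' -> T) V :
  (forall i, measurable_fun setT (Y i)) -> measurable_fun setT (hit h Y V).
Proof.
move=> mY; have [Vl|Vl] := eqVneq #|V| l; last first.
  rewrite (_ : hit h Y V = cst false)//; apply/funext => w.
  by case hw: (hit h Y V w) => //; move: Vl; rewrite (hit_card hw) eqxx.
have [s injs sV] := enum_set Vl.
rewrite (_ : hit h Y V = h \o (fun w => [tuple Y (s i) w | i < l])).
  apply: measurableT_comp => //; apply/measurable_fun_tnthP => i.
  rewrite (_ : _ \o _ = Y (s i)); first exact: mY.
  by apply/funext => w /=; rewrite tnth_mktuple.
by apply/funext => w; rewrite (hitE hsym _ _ injs sV).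
Qed.

Lemma hit_subsample k (s : 'I_k -> 'I_n) (V : {set 'I_n}) w : injective s ->
  V \subset [set s i | i : 'I_k]%SET ->
  hit h Xf V w = hit h (@canon k) (s @^-1: V)%SET (subsample X s w).
Proof.
move=> injs Vs.
have -> : hit h (@canon k) (s @^-1: V)%SET (subsample X s w) =
    hit h (fun i => Xf (s i)) (s @^-1: V)%SET w.
  apply: eq_existsb => t; do 2 congr andb.
  by congr h; apply: eq_from_tnth => i; rewrite !tnth_mktuple /canon tnth_mktuple.
rewrite (hit_comp hsym _ _ _ injs); congr (hit h Xf _ w).
apply/setP => x; apply/idP/imsetP => [xV|[y + ->]]; last by rewrite inE.
by have /imsetP[y _ xy] := fintype.subsetP Vs x xV; exists y => //; rewrite inE -xy.
Qed.

Definition hits (w : O) : {ffun {set 'I_n} -> bool} := [ffun V => hit h Xf V w].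

(** The configuration seen by the points with indices in A; functions of it are
    functions of these points only. *)
Definition hits_in (A : {set 'I_n}) (y : {ffun {set 'I_n} -> bool}) :=
  [ffun V : {set 'I_n} => (V \subset A) && y V].

Lemma measurable_hits y : measurable (hits @^-1` [set y]).
Proof.
rewrite (_ : _ @^-1` _ = [set w | pred1 y [ffun V => hit h Xf V w]]).
  by apply: measurable_bool_family => V; apply: measurable_hit => i; exact: measurable_funPT.
by apply/seteqP; split => w /= /eqP.
Qed.

Let mean_hits := @mean R _ (law P hits).

Lemma mean_hitsE (Q : pred {ffun {set 'I_n} -> bool}) :
  mean_hits (fun y => (Q y)%:R) = fine (P [set w | Q (hits w)]).
Proof. by rewrite (prob_finite P measurable_hits). Qed.

Lemma hits_in_subsample (A : {set 'I_n}) (Q : pred {ffun {set 'I_n} -> bool}) k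
    (s : 'I_k -> 'I_n) : injective s -> [set s i | i : 'I_k]%SET = A ->
  exists2 D : set (k.-tuple T), measurable D &
    [set w | Q (hits_in A (hits w))] = subsample X s @^-1` D.
Proof.
move=> injs sA.
pose b (V : {set 'I_n}) (x : k.-tuple T) :=
  (V \subset A) && hit h (@canon k) (s @^-1: V)%SET x.
exists [set x | Q [ffun V => b V x]].
  apply: measurable_bool_family => V; apply: measurable_and => //.
  by apply: measurable_hit => i; exact: measurable_tnth.
apply/seteqP; split => w; rewrite /preimage /=;
  (rewrite (_ : hits_in A (hits w) = [ffun V => b V (subsample X s w)])//;
   apply/ffunP => V; rewrite !ffunE /b; apply: andb_id2l => VA;
   by apply: hit_subsample => //; rewrite sA).
Qed.

Hypothesis HX : binomial_points K X.

(** Configurations on disjoint index sets depend on disjoint subsamples. *)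
Lemma hits_independent (A B : {set 'I_n}) (Q1 Q2 : pred {ffun {set 'I_n} -> bool}) :
  [disjoint A & B]%B ->
  mean_hits (fun y => (Q1 (hits_in A y) && Q2 (hits_in B y))%:R) =
  mean_hits (fun y => (Q1 (hits_in A y))%:R) * mean_hits (fun y => (Q2 (hits_in B y))%:R).
Proof.
move=> AB.
rewrite (mean_hitsE (fun y => Q1 (hits_in A y) && Q2 (hits_in B y))).
rewrite (mean_hitsE (fun y => Q1 (hits_in A y))) (mean_hitsE (fun y => Q2 (hits_in B y))).
have [s injs sA] := enum_set (erefl #|A|); have [t injt tB] := enum_set (erefl #|B|).
have [D mD DE] := hits_in_subsample Q1 injs sA.
have [D' mD' DE'] := hits_in_subsample Q2 injt tB.
rewrite DE DE' -fineM ?fin_num_measure//; last 2 first.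
- by rewrite -[X in measurable X]setTI; exact: measurable_subsample.
- by rewrite -[X in measurable X]setTI; exact: measurable_subsample.
rewrite -(subsample_independent HX)//; last first.
  move=> p q; apply/eqP => pq.
  have sp : s p \in A by rewrite -sA imset_f.
  have tq : t q \in B by rewrite -tB imset_f.
  by have := disjointFr AB sp; rewrite pq tq.
congr (fine (P _)); rewrite -DE -DE'; apply/seteqP; split => w /=.
  by move=> /andP.
by move=> [-> ->].
Qed.

Lemma ustat_le_law k (u : 'I_k -> 'I_n) v : injective u ->
  P [set w | (ustat h (fun i => Xf (u i)) w <= v)%N] =
  power_prob K k [set x | (ustat h (@canon k) x <= v)%N].
Proof.
move=> inju; rewrite -(subsample_law HX inju); last first.
  rewrite (_ : [set x | _] = [set x | [pred y : {ffun {set 'I_k} -> bool} |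
      (\sum_V y V <= v)%N] [ffun V => hit h (@canon k) V x]]).
    by apply: measurable_bool_family => V; apply: measurable_hit => i; exact: measurable_tnth.
  have e x : (\sum_(V : {set 'I_k}) [ffun V => hit h (@canon k) V x] V)%N = ustat h (@canon k) x.
    by rewrite (ustat_hits hsym); apply: eq_bigr => V _; rewrite ffunE.
  by apply/seteqP; split => x /=; rewrite e.
congr (P _); apply/seteqP; split => w; rewrite /preimage /=;
  (rewrite (_ : ustat h (@canon k) (subsample X u w) = ustat h (fun i => Xf (u i)) w)//;
   congr (_ %/ _)%N; apply: eq_bigr => s _; congr (nat_of_bool (h _));
   by apply: eq_from_tnth => i; rewrite !tnth_mktuple /canon tnth_mktuple).
Qed.

Lemma mean_hit (V : {set 'I_n}) : #|V| = l ->
  mean_hits (fun y => (y V)%:R) = \int[power_prob K l]_x (h x)%:R.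
Proof.
move=> Vl; have [s injs sV] := enum_set Vl.
have mhp := measurable_pred mh.
rewrite (Rintegral_bool _ mhp) -(subsample_law HX injs mhp).
rewrite (mean_hitsE (fun y => y V)); congr (fine (P _)).
by apply/seteqP; split => w; rewrite /preimage /= ffunE (hitE hsym _ _ injs sV).
Qed.

(** Every factor is allowed since the first one vanishes almost surely. *)
Lemma mean_hit0 (V : {set 'I_n}) (f : {ffun {set 'I_n} -> bool} -> R) : #|V| != l ->
  mean_hits (fun y => (y V)%:R * f y) = 0.
Proof.
move=> Vl; apply: big1 => y _; case yV: (y V); last by rewrite mul0r mulr0.
rewrite /law (_ : hits @^-1` [set y] = set0) ?measure0 ?mul0r//.
apply/seteqP; split => // w; rewrite /preimage /= => wy.
by move: yV; rewrite -wy ffunE => hw; move: Vl; rewrite (hit_card hw) eqxx.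
Qed.

(** Enumerate first the common indices, then those of one set only: the two hits
    become the kernel at two tuples with the same initial block. *)
Lemma mean_hit_pair (V U : {set 'I_n}) i (il : (i < l)%N) : #|V| = l -> #|U| = l ->
  #|(V :&: U)%SET| = i ->
  mean_hits (fun y => (y V)%:R * (y U)%:R) =
  \int[power_prob K i]_x
    (\int[power_prob K (l - i)]_y
       (h (tcast (subnKC (ltnW il)) [tuple of x ++ y]))%:R) ^+ 2.
Proof.
move=> Vl Ul VUi.
have VUl : #|(V :\: U)%SET| = (l - i)%N by rewrite cardsD Vl VUi.
have UVl : #|(U :\: V)%SET| = (l - i)%N by rewrite cardsD Ul finset.setIC VUi.
have [c injc cE] := enum_set VUi.
have [a inja aE] := enum_set VUl.
have [b injb bE] := enum_set UVl.
have cV p : c p \in V /\ c p \in U.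
  have : c p \in (V :&: U)%SET by rewrite -cE imset_f.
  by rewrite inE => /andP.
have aV p : a p \in V /\ a p \notin U.
  have : a p \in (V :\: U)%SET by rewrite -aE imset_f.
  by rewrite inE => /andP[].
have bU p : b p \in U /\ b p \notin V.
  have : b p \in (U :\: V)%SET by rewrite -bE imset_f.
  by rewrite inE => /andP[].
have ca p q : c p != a q by apply/eqP => e; have := (aV q).2; rewrite -e (cV p).2.
have cb p q : c p != b q by apply/eqP => e; have := (bU q).2; rewrite -e (cV p).1.
have ab p q : a p != b q by apply/eqP => e; have := (bU q).2; rewrite -e (aV p).1.
rewrite -(overlap_pairE HX (subnKC (ltnW il)) mh injc inja injb ca cb ab).
transitivity (mean_hits (fun y => (y V && y U)%:R)).
  by apply: eq_mean => y; rewrite -natrM mulnb.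
rewrite (mean_hitsE (fun y => y V && y U)); congr (fine (P _)).
have key (W : {set 'I_n}) (a' : 'I_(l - i) -> 'I_n) w : #|W| = l -> injective a' ->
    (forall p q, c p != a' q) -> (forall p, c p \in W) -> (forall p, a' p \in W) ->
    hit h Xf W w =
    h (tcast (subnKC (ltnW il)) [tuple of subsample X c w ++ subsample X a' w]).
  move=> Wl inja' ca' cW aW.
  have [u [inju ul ur]] := inj_cat injc inja' ca'.
  pose s p := u (cast_ord (esym (subnKC (ltnW il))) p).
  have injs : injective s by move=> p q /inju /cast_ord_inj.
  have sW : [set s i | i : 'I_l]%SET = W.
    apply/eqP; rewrite eqEcard card_imset// card_ord Wl leqnn andbT.
    apply/fintype.subsetP => _ /imsetP[p _ ->]; rewrite /s.
    by case: (split_ordP (cast_ord (esym (subnKC (ltnW il))) p)) => q ->; rewrite ?ul ?ur.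
  rewrite (hitE hsym _ _ injs sW); congr h; apply: eq_from_tnth => p.
  rewrite tnth_mktuple tcastE /s.
  case: (split_ordP (cast_ord (esym (subnKC (ltnW il))) p)) => q ->.
    by rewrite tnth_lshift tnth_mktuple ul.
  by rewrite tnth_rshift tnth_mktuple ur.
apply/seteqP; split => w /=; rewrite !ffunE;
  rewrite (key V a)// 1?(key U b)//;
  by [move=> p; have [] := cV p | move=> p; have [] := aV p | move=> p; have [] := bU p].
Qed.

End hit_events.

Section law_range.
Context {d} {O : measurableType d} {R : realType} {F : finType}.
Variables (P : probability O R) (Y : O -> F).

Lemma ler_mean_law (f g : F -> R) :
  (forall w, f (Y w) <= g (Y w)) -> mean (law P Y) f <= mean (law P Y) g.
Proof.
move=> fg; apply: ler_sum => y _.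
have [[w <-]|nw] := pselect (exists w, Y w = y); first by rewrite ler_wpM2l ?law_ge0.
rewrite /law (_ : Y @^-1` [set y] = set0) ?measure0 ?mul0r//.
by apply/seteqP; split => // w yw; case: nw; exists w.
Qed.

Lemma eq_mean_law (f g : F -> R) :
  (forall w, f (Y w) = g (Y w)) -> mean (law P Y) f = mean (law P Y) g.
Proof. by move=> fg; apply: le_anti; rewrite !ler_mean_law// => w; rewrite fg. Qed.

End law_range.

(** * Poisson approximation of the U-statistic *)

Section ustat_poisson.
Context {d dO} {T : measurableType d} {O : measurableType dO} {R : realType}.
Variables (P : probability O R) (K : probability T R) (n l : nat).
Variables (X : 'I_n -> {RV P >-> T}) (h : l.-tuple T -> bool).
Hypothesis l0 : (0 < l)%N.
Hypothesis ln : (2 * l <= n)%N.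
Hypothesis mh : measurable_fun setT h.
Hypothesis hsym : symmetric_kernel h.
Hypothesis HX : binomial_points K X.

Local Notation configuration := {ffun {set 'I_n} -> bool}.
Local Notation M := (mean (law P (hits X h))).

Let Xf (i : 'I_n) : O -> T := X i.

(** Sets whose cardinality is not l never get hit; making them neighbours of
    themselves only keeps the relation reflexive without disturbing the sums. *)
Definition overlapping (V U : {set 'I_n}) : bool :=
  (V == U) || [&& #|V| == l, #|U| == l & ~~ [disjoint V & U]%B].

Let xi (V : {set 'I_n}) (y : configuration) : bool := y V.

Let hits_card (V : {set 'I_n}) w : hits X h w V -> #|V| = l.
Proof. by rewrite ffunE => hw; exact: hit_card hw. Qed.

Let away_hits (V : {set 'I_n}) w : #|V| = l ->
  away overlapping xi V (hits X h w) = (\sum_U hits_in (~: V) (hits X h w) U)%N.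
Proof.
move=> Vl; rewrite /away big_mkcond; apply: eq_bigr => U _; rewrite [in RHS]ffunE /xi.
case yU: (hits X h w U); last by rewrite andbF; case: ifP.
have Ul := hits_card yU; rewrite andbT /overlapping Vl Ul eqxx /=.
rewrite -finset.disjoints_subset disjoint_sym negb_or negbK.
case VU: [disjoint V & U]%B; last by rewrite andbF.
rewrite andbT; case: eqP => // VeU; move: VU; rewrite -VeU -finset.setI_eq0 finset.setIid.
by rewrite -cards_eq0 Vl => /eqP lz; move: l0; rewrite lz.
Qed.

Let indep_hits (V : {set 'I_n}) k :
  M (fun y => (xi V y)%:R * (away overlapping xi V y == k)%:R) =
  M (fun y => (xi V y)%:R) * M (fun y => (away overlapping xi V y == k)%:R).
Proof.
have [Vl|Vl] := eqVneq #|V| l; last first.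
  rewrite mean_hit0// (_ : M (fun y => (xi V y)%:R) = 0) ?mul0r//.
  rewrite -[RHS](mean_hit0 X h (fun=> 1) Vl).
  by apply: eq_mean => y; rewrite mulr1.
pose Q1 (y : configuration) := y V.
pose Q2 (y : configuration) := (\sum_U y U)%N == k.
have VV y : hits_in V y V = y V by rewrite ffunE subxx.
have dV : [disjoint V & ~: V]%B by rewrite finset.disjoints_subset finset.setCK.
have := hits_independent mh hsym HX Q1 Q2 dV => H.
transitivity (M (fun y => (Q1 (hits_in V y) && Q2 (hits_in (~: V) y))%:R)).
  by apply: eq_mean_law => w; rewrite away_hits// /Q1 VV -natrM mulnb.
rewrite H; congr (_ * _); first by apply: eq_mean => y; rewrite /Q1 VV.
by apply: eq_mean_law => w; rewrite away_hits.
Qed.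

Definition below_prob k : R :=
  fine (power_prob K (n - 2 * l)
    [set x | (ustat h (fun i (x : (n - 2 * l).-tuple T) => tnth x i) x <= k)%N]).

Lemma below_prob_ge0 k : 0 <= below_prob k.
Proof. by rewrite fine_ge0. Qed.

(** Restricting the count to n - 2 l indices outside V and U, which is possible
    since V and U have together at most 2 l elements, can only decrease it; the
    restricted count is independent of the configuration on V and U. *)
Let away2_threshold (V U : {set 'I_n}) (Q : pred configuration) k :
  #|V| = l -> #|U| = l ->
  M (fun y => (Q (hits_in (V :|: U) y))%:R * (away2 overlapping xi V U y <= k)%:R) <=
  M (fun y => (Q (hits_in (V :|: U) y))%:R) * below_prob k.
Proof.
move=> Vl Ul.
have cC : (n - 2 * l <= #|~: (V :|: U)|)%N.
  have := cardsC (V :|: U)%SET; have := cardsU V U; rewrite card_ord Vl Ul; lia.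
have [s injs sC] := enum_set (erefl #|~: (V :|: U)|).
pose u i := s (widen_ord cC i).
have inju : injective u by move=> i j /injs /(congr1 val) /= ij; exact: val_inj.
pose B := [set u i | i : 'I_(n - 2 * l)]%SET.
have BC : B \subset (~: (V :|: U))%SET.
  by apply/fintype.subsetP => _ /imsetP[i _ ->]; rewrite -sC /u; exact: imset_f.
have dB : [disjoint (V :|: U)%SET & B]%B by rewrite disjoint_sym finset.disjoints_subset.
pose Q2 (y : configuration) := (\sum_W y W <= k)%N.
have -> : below_prob k = M (fun y => (Q2 (hits_in B y))%:R).
  rewrite /below_prob -(ustat_le_law mh hsym HX _ inju) (mean_hitsE X mh hsym (fun y => Q2 (hits_in B y))).
  have eB w : ustat h (fun i => Xf (u i)) w = (\sum_W hits_in B (hits X h w) W)%N.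
    rewrite (ustat_comp hsym Xf w inju) big_mkcond /=.
    by apply: eq_bigr => W _; rewrite !ffunE; case: (W \subset B).
  by congr (fine (P _)); apply/seteqP; split => w /=; rewrite /Q2 -eB.
rewrite -(hits_independent mh hsym HX Q Q2 dB); apply: ler_mean_law => w.
rewrite -natrM mulnb ler_nat.
case: (Q _) => //=; rewrite /Q2.
suff le : (\sum_W hits_in B (hits X h w) W <= away2 overlapping xi V U (hits X h w))%N.
  by case: (leqP (away2 _ _ _ _ _) k) => // ik; rewrite (leq_trans le ik).
rewrite /away2 [X in (_ <= X)%N]big_mkcond; apply: leq_sum => W _.
rewrite ffunE /xi; case yW: (hits X h w W); last by rewrite andbF.
rewrite andbT; case WB: (W \subset B) => //.
have Wl := hits_card yW.
have /fintype.subsetP WC := fintype.subset_trans WB BC.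
have out (V' : {set 'I_n}) : (V' \subset (V :|: U)%SET) -> ~~ overlapping V' W.
  move=> V'VU; have dW : [disjoint V' & W]%B.
    rewrite disjoint_sym finset.disjoints_subset; apply/fintype.subsetP => x /WC.
    by rewrite !finset.in_setC; apply: contra => /(fintype.subsetP V'VU).
  rewrite /overlapping dW !andbF orbF; apply/eqP => VW.
  move: dW; rewrite VW -finset.setI_eq0 finset.setIid -cards_eq0 Wl => /eqP lz.
  by move: l0; rewrite lz.
by rewrite !out ?finset.subsetUl ?finset.subsetUr.
Qed.

Let tau_pair (V U : {set 'I_n}) k : overlapping V U -> V != U ->
  M (fun y => (xi V y)%:R * (xi U y)%:R * (away2 overlapping xi V U y <= k)%:R) <=
  M (fun y => (xi V y)%:R * (xi U y)%:R) * below_prob k.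
Proof.
move=> + /negbTE VU; rewrite /overlapping VU /= => /and3P[/eqP Vl /eqP Ul _].
have := away2_threshold (fun y => y V && y U) k Vl Ul.
have e y : ((hits_in (V :|: U) y V && hits_in (V :|: U) y U)%:R : R) =
    (xi V y)%:R * (xi U y)%:R.
  by rewrite !ffunE finset.subsetUl finset.subsetUr /= -natrM mulnb.
congr (_ <= _ * _); first by apply: eq_mean => y; rewrite e.
by apply: eq_mean => y; rewrite e.
Qed.

Let tau_single (V U : {set 'I_n}) k : overlapping V U ->
  M (fun y => (xi U y)%:R * (away2 overlapping xi V U y <= k)%:R) <=
  M (fun y => (xi U y)%:R) * below_prob k.
Proof.
move=> VU; have [Ul|Ul] := eqVneq #|U| l; last first.
  rewrite mean_hit0// mulr_ge0 ?below_prob_ge0//.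
  by apply: mean_ge0 => // y; exact: law_ge0.
have Vl : #|V| = l by move: VU => /orP[/eqP ->|/and3P[/eqP]].
have := away2_threshold (fun y => y U) k Vl Ul.
have e y : ((hits_in (V :|: U) y U)%:R : R) = (xi U y)%:R.
  by rewrite !ffunE finset.subsetUr.
congr (_ <= _ * _); first by apply: eq_mean => y; rewrite e.
by apply: eq_mean => y; rewrite e.
Qed.

Let p : R := \int[power_prob K l]_x (h x)%:R.

Let p0 : 0 <= p. Proof. by apply: Rintegral_ge0 => x _. Qed.

Let mean_xi V : M (fun y => (xi V y)%:R) = if #|V| == l then p else 0.
Proof.
case: eqP => [Vl|/eqP Vl]; first exact: (mean_hit mh hsym HX Vl).
rewrite -[RHS](mean_hit0 X h (fun=> 1) Vl).
by apply: eq_mean => y; rewrite mulr1.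
Qed.

Lemma sum_mean_hits : \sum_V M (fun y => (xi V y)%:R) = 'C(n, l)%:R * p.
Proof.
rewrite (eq_bigr (fun V : {set 'I_n} => if #|V| == l then p else 0)) => [|V _]; last exact: mean_xi.
rewrite -big_mkcond sumr_const mulr_natl -card_lsets; congr (_ *+ _).
by apply: eq_card => V; rewrite inE.
Qed.

Let r : R := overlap K h n.

Let r0 : 0 <= r.
Proof.
rewrite /r /overlap; elim/big_ind: _ => // [a b a0 b0|i _]; first by rewrite le_max a0.
by rewrite mulr_ge0//; apply: Rintegral_ge0 => x _; exact: sqr_ge0.
Qed.

Let nl : (l <= n)%N. Proof. by move: ln; lia. Qed.

Let nl2 : (l <= n - l)%N. Proof. by move: ln; lia. Qed.

Let C0 : 0 < 'C(n, l)%:R :> R. Proof. by rewrite ltr0n bin_gt0. Qed.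

Let lfact0 : 0 < l`!%:R :> R. Proof. by rewrite ltr0n fact_gt0. Qed.

(** Each intersection cardinality i has its own term in the maximum r, and
   [lsets_pairs_le] absorbs the number of pairs with this intersection. *)
Let mean_pair_le (V U : {set 'I_n}) : overlapping V U -> V != U ->
  M (fun y => (xi V y)%:R * (xi U y)%:R) <=
  r / (l`!%:R * 'C(n, l)%:R) / 'C(n - l, l - #|(V :&: U)%SET|)%:R.
Proof.
move=> + VU; rewrite /overlapping (negbTE VU) /= => /and3P[/eqP Vl /eqP Ul dVU].
set i := #|(V :&: U)%SET|.
have i0 : (0 < i)%N by rewrite card_gt0 finset.setI_eq0.
have il : (i < l)%N.
  rewrite ltn_neqAle -{2}Vl subset_leq_card ?finset.subsetIl// andbT.
  apply: contra VU => /eqP il; have VU : (V \subset U).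
    by apply/finset.setIidPl/eqP; rewrite eqEcard finset.subsetIl Vl -/i il leqnn.
  by rewrite eqEcard VU Vl Ul leqnn.
rewrite (mean_hit_pair mh hsym HX il Vl Ul (erefl _)).
set ov := \int[_]_x _.
have ov0 : 0 <= ov by apply: Rintegral_ge0 => x _; exact: sqr_ge0.
have rov : (n ^_ (2 * l - i))%:R * ov <= r.
  apply: (bigmax_sup (Ordinal il)); first exact: i0.
  by rewrite /ov (bool_irrelevance (ltn_ord (Ordinal il)) il).
have Ci : 0 < 'C(n - l, l - i)%:R :> R by rewrite ltr0n bin_gt0 (leq_trans (leq_subr _ _) nl2).
rewrite ler_pdivlMr// ler_pdivlMr ?mulr_gt0//.
apply: le_trans rov; rewrite -mulrA [ov * _]mulrC -natrM -natrM ler_wpM2r// ler_nat.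
by rewrite mulnCA mulnC [('C(n - l, _) * _)%N]mulnC; exact: lsets_pairs_le (ltnW il) nl.
Qed.

(** The sets U are grouped by their trace on V; each of the 2 ^ l traces
   contributes at most r / l! after summation over V. *)
Let sum_pairs_le :
  \sum_V \sum_(U | overlapping V U && (V != U)) M (fun y => (xi V y)%:R * (xi U y)%:R) <=
  2 ^+ l * r / l`!%:R.
Proof.
pose q := r / (l`!%:R * 'C(n, l)%:R).
have q0 : 0 <= q by rewrite divr_ge0// mulr_ge0.
have inner (V : {set 'I_n}) : #|V| = l ->
    \sum_(U | overlapping V U && (V != U)) M (fun y => (xi V y)%:R * (xi U y)%:R) <=
    2 ^+ l * q.
  move=> Vl; apply: le_trans (_ : \sum_(U : {set 'I_n} | #|U| == l)
      q / 'C(n - l, l - #|(V :&: U)%SET|)%:R <= _).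
    rewrite big_mkcond [leRHS]big_mkcond /=; apply: ler_sum => U _.
    case: ifP => [/andP[oVU VU]|_]; last by case: ifP => // _; rewrite divr_ge0.
    have := oVU; rewrite {1}/overlapping (negbTE VU) /= => /and3P[_ -> _].
    exact: mean_pair_le.
  rewrite (partition_big (fun U => (V :&: U)%SET) (mem (powerset V))) /=; last first.
    by move=> U _; rewrite powersetE finset.subsetIl.
  apply: le_trans (_ : \sum_(A in powerset V) q <= _); last first.
    by rewrite sumr_const card_powerset Vl -[q *+ _]mulr_natl natrX.
  apply: ler_sum => A; rewrite powersetE => AV.
  rewrite (eq_bigr (fun=> q / 'C(n - l, l - #|A|)%:R)) => [|U /andP[_ /eqP ->]//].
  rewrite sumr_const -[_ *+ _]mulr_natl.
  have Ci : 0 < 'C(n - l, l - #|A|)%:R :> R.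
    by rewrite ltr0n bin_gt0 (leq_trans (leq_subr _ _) nl2).
  rewrite mulrCA ler_piMr// ler_pdivrMr// mul1r ler_nat.
  have := card_fixed_trace l V A; rewrite Vl; apply: leq_trans.
  by apply: eq_leq; apply: eq_card => U; rewrite inE.
apply: le_trans (_ : \sum_(V : {set 'I_n} | #|V| == l) 2 ^+ l * q <= _).
  rewrite [leRHS]big_mkcond; apply: ler_sum => V _.
  case: eqP => [/inner//|/eqP Vl]; rewrite big1// => U /andP[+ VU].
  by rewrite /overlapping (negbTE VU) (negbTE Vl).
rewrite sumr_const -[_ *+ _]mulr_natl (_ : #|_| = 'C(n, l)); last first.
  by rewrite -card_lsets; apply: eq_card => V; rewrite inE.
rewrite /q le_eqVlt; apply/orP; left; apply/eqP.
by field; rewrite !lt0r_neq0.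
Qed.

Let sum_singles_le (lambda := 'C(n, l)%:R * p) :
  \sum_V \sum_(U | overlapping V U) M (fun y => (xi V y)%:R) * M (fun y => (xi U y)%:R) <=
  l%:R ^+ 2 * lambda ^+ 2 / n%:R.
Proof.
have n0 : 0 < n%:R :> R by rewrite ltr0n (leq_trans l0 nl).
apply: le_trans (_ : \sum_(V : {set 'I_n} | #|V| == l)
    p ^+ 2 * (l%:R ^+ 2 * 'C(n, l)%:R / n%:R) <= _).
  rewrite [leRHS]big_mkcond; apply: ler_sum => V _; rewrite mean_xi.
  case: eqP => [Vl|_]; last by rewrite big1// => U _; rewrite mul0r.
  apply: le_trans (_ : \sum_(U : {set 'I_n} | (#|U| == l) && ~~ [disjoint V & U]%B) p ^+ 2 <= _).
    rewrite big_mkcond [leRHS]big_mkcond; apply: ler_sum => U _; rewrite mean_xi.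
    case: ifP => [|_]; last by case: ifP => // _; exact: sqr_ge0.
    move=> oVU; have [Ul|_] := eqVneq #|U| l; last by rewrite mulr0.
    rewrite (_ : ~~ [disjoint V & U]%B) ?expr2//.
    case/orP: oVU => [/eqP <-|/and3P[]//].
    by rewrite -finset.setI_eq0 finset.setIid -cards_eq0 Vl -lt0n.
  rewrite sumr_const -[_ *+ _]mulr_natr ler_wpM2l ?sqr_ge0// ler_pdivlMr//.
  rewrite expr2 -!natrM ler_nat mulnC; have := card_meeting l0 Vl.
  by congr (_ * _ <= _)%N; apply: eq_card => U; rewrite inE.
rewrite sumr_const -[_ *+ _]mulr_natl (_ : #|_| = 'C(n, l)); last first.
  by rewrite -card_lsets; apply: eq_card => V; rewrite inE.
rewrite /lambda le_eqVlt; apply/orP; left; apply/eqP.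
by field; rewrite lt0r_neq0.
Qed.

Let total_hits w : total xi (hits X h w) = ustat h Xf w.
Proof. by rewrite (ustat_hits hsym); apply: eq_bigr => V _; rewrite /xi ffunE. Qed.

Lemma mean_total :
  M (fun y => (total xi y)%:R) = 'C(n, l)%:R * \int[power_prob K l]_x (h x)%:R.
Proof.
rewrite -/p -sum_mean_hits -mean_sum; apply: eq_mean => y.
by rewrite /total natr_sum.
Qed.

Lemma ustat_mean (f : nat -> R) :
  (\int[P]_w (f (ustat h Xf w))%:E = (M (fun y => f (total xi y)))%:E)%E.
Proof.
rewrite -(integral_finite P (measurable_hits X mh hsym)).
by apply: eq_integral => w _; rewrite total_hits.
Qed.

Lemma ustat_prob (b : pred nat) :
  P [set w | b (ustat h Xf w)] = (M (fun y => (b (total xi y))%:R))%:E.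
Proof.
rewrite -(prob_finite P (measurable_hits X mh hsym)); congr (P _).
by apply/seteqP; split => w /=; rewrite total_hits.
Qed.

(** The Stein equation turns the difference of means into the quantity bounded in
    [dissociated_stein_chen], whose two sums are controlled by r and by
    [card_meeting]. *)
Lemma ustat_stein (f : nat -> R) (mf : R) (lambda := 'C(n, l)%:R * p)
    (cinf : R) (m : nat) (c : nat -> R) : 0 < lambda -> 0 <= cinf ->
  (forall k, 0 <= c k) ->
  (forall s a b, (s < a)%N -> (s < b)%N ->
     `|stein lambda f mf a - stein lambda f mf b| <=
     (cinf + \sum_(k < m) c k * (s <= k)%:R) * `|a%:R - b%:R|) ->
  `|M (fun y => f (total xi y)) - mf| <=
  (cinf + \sum_(k < m) c k * below_prob k) *
  (2 ^+ l * r / l`!%:R + 2 * l%:R ^+ 2 * lambda ^+ 2 / n%:R).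
Proof.
move=> lam0 cinf0 c0 osc; set g := stein lambda f mf in osc *.
have law0 y : 0 <= law P (hits X h) y by exact: law_ge0.
have -> : M (fun y => f (total xi y)) - mf =
    - (M (fun y => (total xi y)%:R * g (total xi y)) -
       (\sum_V M (fun y => (xi V y)%:R)) * M (fun y => g (total xi y).+1)).
  rewrite sum_mean_hits -/lambda opprB -meanZl -meanB.
  have {1}-> : mf = M (fun=> mf).
    rewrite /mean -mulr_suml law_sum1 ?mul1r//; exact: measurable_hits.
  rewrite -meanB; apply: eq_mean => y.
  by rewrite -(steinE f mf (total xi y) (lt0r_neq0 lam0)).
rewrite normrN.
apply: le_trans (dissociated_stein_chen law0 _ indep_hits tau_pair tau_single c0 osc) _.
  by move=> V; rewrite /overlapping eqxx.
apply: ler_wpM2l.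
  by rewrite addr_ge0// sumr_ge0// => k _; rewrite mulr_ge0// below_prob_ge0.
apply: lerD; first exact: sum_pairs_le.
apply: le_trans sum_singles_le _; rewrite -/lambda -!mulrA ler_peMl ?ler1n//.
by rewrite !mulr_ge0 ?invr_ge0 ?exprn_ge0.
Qed.

End ustat_poisson.

Theorem theorem3p1 (R : realType)
    (d : measure_display) (T : measurableType d) (K : probability T R)
    (l n : nat) (l_gt0 : (0 < l)%N) (le_2l_n : (2 * l <= n)%N)
    (h : l.-tuple T -> bool)
    (mh : measurable_fun [set: l.-tuple T] h) (hsym : symmetric_kernel h)
    (* the points of beta_n *)
    (dO : measure_display) (O : measurableType dO) (P : probability O R)
    (X : 'I_n -> {RV P >-> T}) (HX : binomial_points K X)
    (* the points of beta_(n - 2l), possibly on another probability space *)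
    (dO' : measure_display) (O' : measurableType dO') (P' : probability O' R)
    (X' : 'I_(n - 2 * l) -> {RV P' >-> T}) (HX' : binomial_points K X')
    (lambda : R) (lambda_gt0 : 0 < lambda)
    (lambdaE : ('E_P[fun w => (ustat h X w)%:R] = lambda%:E)%E)
    (dZ : measure_display) (OZ : measurableType dZ) (Q : probability OZ R)
    (Z : {RV Q >-> nat}) (HZ : poisson_variable Z lambda) :
  let S := ustat h X in
  let S' := ustat h X' in
  let r := overlap K h n in
  let B := 2 ^+ l * r / (l`!%:R * lambda) + 2 * l%:R ^+ 2 * lambda / n%:R in
  [/\ lambda = (n ^_ l)%:R / l`!%:R * \int[power_prob K l]_x (h x)%:R,
      (dTV P S Q Z <= (Num.min 1 lambda * B)%:E)%E,
      (dW P S Q Z <=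
         (Num.min ((1 + 1437 / 10 ^+ 4) * Num.sqrt lambda) lambda * B)%:E)%E,
      forall m : nat, (0 < m)%N ->
        `|fine (P [set w | S w = 0%N]) - expR (- lambda)| <=
          (\sum_(0 <= k < m)
             Num.min (lambda / k.+1%:R) (k`!%:R / lambda ^+ k) *
             fine (P' [set w | (S' w <= k)%N])
           + m`!%:R / lambda ^+ m) * B
    & forall v : nat, (0 < v)%N ->
        `|fine (P [set w | (S w <= v)%N]) - fine (Q [set w | (Z w <= v)%N])| <=
          (v.+1%:R ^+ 2 / lambda + fine (P' [set w | (S' w <= v)%N])) * B].
Proof.
move=> S S' r B.
have lam0 := lt0r_neq0 lambda_gt0; have lam_ge0 := ltW lambda_gt0.
have lfact : l`!%:R != 0 :> R := factr_neq0 l.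
pose p : R := \int[power_prob K l]_x (h x)%:R.
have lamE : lambda = 'C(n, l)%:R * p.
  apply: EFin_inj; rewrite -lambdaE unlock /p -(mean_total mh hsym HX).
  by rewrite -(ustat_mean X mh hsym (fun j => j%:R)).
have tauE k : below_prob K n h k = fine (P' [set w | (S' w <= k)%N]).
  by rewrite /below_prob -(ustat_le_law mh hsym HX' k (fun i j (e : id i = id j) => e)).
pose M := mean (law P (hits X h)).
pose tot := total (fun (V : {set 'I_n}) (y : {ffun {set 'I_n} -> bool}) => y V).
have bound (f : nat -> R) (mf cinf : R) m (c : nat -> R) : 0 <= cinf -> (forall k, 0 <= c k) ->
    (forall s a b, (s < a)%N -> (s < b)%N ->
       `|stein lambda f mf a - stein lambda f mf b| <=
       (cinf + \sum_(k < m) c k * (s <= k)%:R) * `|a%:R - b%:R|) ->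
    `|M (fun y => f (tot y)) - mf| <=
    (lambda * cinf + \sum_(k < m) lambda * c k * fine (P' [set w | (S' w <= k)%N])) * B.
  move=> cinf0 c0 osc.
  have := @ustat_stein _ _ _ _ _ P K n l X h l_gt0 le_2l_n mh hsym HX f mf cinf m c.
  rewrite -/p -lamE => /(_ lambda_gt0 cinf0 c0 osc); congr (_ <= _).
  rewrite (eq_bigr (fun k : 'I_m => c k * fine (P' [set w | (S' w <= k)%N]))) => [|k _]; last first.
    by rewrite tauE.
  rewrite (eq_bigr (F1 := fun k : 'I_m => lambda * c k * _)
    (fun k : 'I_m => lambda * (c k * fine (P' [set w | (S' w <= k)%N])))) => [|k _]; last first.
    by rewrite mulrA.
  rewrite -mulr_sumr -mulrDr /B; set s := cinf + _.
  have nn : n%:R != 0 :> R by rewrite pnatr_eq0; move: l_gt0 le_2l_n; lia.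
  rewrite -/r; clearbody r s; move: (2 ^+ l) => e.
  by move: (l`!%:R) lfact (l%:R) (n%:R) nn => a a0 b b' b'0; field; rewrite a0 b'0 lam0.
have const_bound (f : nat -> R) (mf c : R) : 0 <= c ->
    (forall k, (0 < k)%N -> `|stein lambda f mf k.+1 - stein lambda f mf k| <= c) ->
    `|M (fun y => f (tot y)) - mf| <= lambda * c * B.
  move=> c0 step; have := bound f mf c 0%N (fun=> 0) c0 (fun=> lexx _).
  rewrite big_ord0 addr0; apply => s a b sa sb; rewrite big_ord0 addr0.
  by apply: (dist_from_steps (s := s)) => // k sk; apply: step; exact: leq_ltn_trans sk.
have probS (b : pred nat) : P [set w | b (S w)] = (M (fun y => (b (tot y))%:R))%:E.
  exact: (ustat_prob X mh hsym b).
have segQ v : forall i, \sum_(j < i) pois lambda j * (j <= v)%:R <= pois_lt lambda v.+1 <=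
    \sum_(j < i) pois lambda j * (j <= v)%:R + pois_ge lambda i.
  move=> i; have := prob_poisson_between lambda_gt0 HZ (fun j => (j <= v)%N) i.
  rewrite -(prob_le_poisson lambda_gt0 HZ v).
  by under eq_bigr do rewrite asboolb.
split.
- by rewrite lamE -bin_ffact natrM mulfK.
- apply: ub_ereal_sup => _ [A _ <-].
  have -> : P (S @^-1` A) = (M (fun y => (`[< A (tot y) >])%:R))%:E.
    rewrite -(probS (fun j => `[< A j >])); congr (P _).
    by apply/seteqP; split => w; rewrite /preimage /= => /asboolP.
  have mZA : measurable (Z @^-1` A).
    by rewrite -[X in measurable X]setTI; exact: (measurable_funPT Z).
  rewrite -[Q _]fineK ?fin_num_measure// -EFinB abse_EFin lee_fin.
  have -> : Num.min 1 lambda = lambda * Num.min 1 lambda^-1.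
    by rewrite minr_pMr// mulr1 mulfV// minC.
  apply: (const_bound (fun j => (`[< A j >])%:R)); first by rewrite le_min ler01 invr_ge0.
  move=> k k0; apply: (@stein_indicator_step _ _ (fun j => `[< A j >])) => // i.
  exact: (prob_poisson_between lambda_gt0 HZ).
- apply: ub_ereal_sup => _ [g lg <-].
  have [m mE mb] := poisson_lipschitz_mean lambda_gt0 HZ lg.
  rewrite !unlock mE (ustat_mean X mh hsym g) -EFinB abse_EFin lee_fin.
  set c := 1 + _.
  have -> : Num.min (c * Num.sqrt lambda) lambda = lambda * Num.min 1 (c / Num.sqrt lambda).
    rewrite minr_pMr// mulr1 minC; congr Num.min.
    rewrite mulrCA; congr (c * _).
    by rewrite -[X in X / _](sqr_sqrtr lam_ge0) expr2 mulfK// gt_eqF ?sqrtr_gt0.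
  apply: (const_bound g) => [|k k0].
    rewrite le_min ler01 /=; apply: divr_ge0; last exact: sqrtr_ge0.
    by rewrite /c; lra.
  apply: le_trans (stein_lipschitz_step lambda_gt0 k0 lg (mb k)) _.
  apply: le_trans (lipschitz_factor lambda_gt0 k0) _.
  rewrite !le_min !ge_min lexx /=; apply/orP; right.
  exact: lipschitz_factor_numeric.
- move=> m m0.
  (* Stein solution for the indicator of 0: it is nonnegative and decreasing, so its
     value at s.+1 bounds all increments beyond s. *)
  pose cc k : R := Num.min (lambda / k.+1%:R) (k`!%:R / lambda ^+ k) / lambda.
  have cc0 k : 0 <= cc k by rewrite divr_ge0// le_min !divr_ge0 ?exprn_ge0.
  have -> : P [set w | S w = 0%N] = (M (fun y => ((tot y <= 0)%N)%:R))%:E.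
    rewrite -(probS (fun j => (j <= 0)%N)); congr (P _); apply/seteqP; split => w /=; first by move=> ->.
    by rewrite leqn0 => /eqP.
  have eE : expR (- lambda) = pois_lt lambda 1.
    by rewrite pois_ltS pois_lt0 add0r pois.unlock expr0 fact0 divr1 mul1r.
  rewrite eE /=.
  have g_le k : stein lambda (fun j => (j <= 0)%:R) (pois_lt lambda 1) k.+1 <= cc k.
    by rewrite /cc ler_pdivlMr// mulrC; exact: stein_point0_le.
  have := bound (fun j => (j <= 0)%:R) (pois_lt lambda 1) (m`!%:R / lambda ^+ m / lambda) m cc.
  rewrite [lambda * (_ / _ / _)]mulrC divfK// big_mkord [_ + m`!%:R / _]addrC.
  rewrite (eq_bigr (F1 := fun k : 'I_m => lambda * cc k * _) (fun k : 'I_m =>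
    Num.min (lambda / k.+1%:R) (k`!%:R / lambda ^+ k) * fine (P' [set w | (S' w <= k)%N])));
    last by move=> k _; rewrite /cc [lambda * _]mulrC divfK.
  apply => //; first by rewrite !divr_ge0 ?exprn_ge0.
  move=> s a b sa sb.
  apply: le_trans (stein_segment_dist lambda_gt0 (leq0n s) sa sb) _.
  rewrite ler_wpM2r//; have [sm|ms] := ltnP s m.
    apply: le_trans (g_le s) _.
    rewrite (bigD1 (Ordinal sm)) //= leqnn mulr1 addrCA lerDl addr_ge0//.
      by rewrite !divr_ge0 ?exprn_ge0.
    by apply: sumr_ge0 => k _; rewrite mulr_ge0.
  apply: le_trans (stein_segment_homo lambda_gt0 (ltn0Sn m) (_ : (m.+1 <= s.+1)%N)) _ => //.
  apply: le_trans (g_le m) _; rewrite /cc -[leLHS]addr0 lerD//.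
    by rewrite ler_wpM2r ?invr_ge0// ge_min lexx orbT.
  by apply: sumr_ge0 => k _; apply: mulr_ge0 => //; exact: cc0.
- move=> v v0.
  rewrite (prob_le_poisson lambda_gt0 HZ) (probS (fun j => (j <= v)%N)) /=.
  (* All the weight at the threshold v: the increments are at most 1 / lambda
     everywhere, and much smaller beyond v when lambda is large. *)
  pose cv k : R := (k == v)%:R / lambda.
  have := bound (fun j => (j <= v)%:R) (pois_lt lambda v.+1) (v.+1%:R ^+ 2 / lambda ^+ 2) v.+1 cv.
  have sumv (F : nat -> R) : \sum_(k < v.+1) cv k * F k = F v / lambda.
    rewrite big_ord_recr /= /cv eqxx big1 ?add0r ?mul1r 1?mulrC// => i _.
    by rewrite (ltn_eqF (ltn_ord i)) !mul0r.
  have -> : \sum_(k < v.+1) lambda * cv k * fine (P' [set w | (S' w <= k)%N]) =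
      fine (P' [set w | (S' w <= v)%N]).
    under eq_bigr do rewrite -mulrA.
    rewrite -mulr_sumr (sumv (fun k => fine (P' [set w | (S' w <= k)%N]))).
    by rewrite mulrC divfK.
  have -> : lambda * (v.+1%:R ^+ 2 / lambda ^+ 2) = v.+1%:R ^+ 2 / lambda.
    by move: (v.+1%:R) => a; field.
  apply; first by rewrite divr_ge0 ?exprn_ge0.
    by move=> k; rewrite divr_ge0.
  move=> s a b sa sb; rewrite (sumv (fun k => (s <= k)%:R)).
  have step : (forall k, (s < k)%N -> `|stein lambda (fun j => (j <= v)%:R) (pois_lt lambda v.+1) k.+1 -
      stein lambda (fun j => (j <= v)%:R) (pois_lt lambda v.+1) k| <= lambda^-1).
    move=> k sk; have k0 : (0 < k)%N by exact: leq_ltn_trans sk.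
    apply: le_trans (stein_indicator_step lambda_gt0 k0 (segQ v)) _.
    by rewrite ge_min lexx orbT.
  have [sv|vs] := leqP s v.
    apply: le_trans (dist_from_steps step sa sb) _.
    by rewrite ler_wpM2r// mul1r lerDr divr_ge0 ?exprn_ge0.
  rewrite mul0r addr0; have [vl|lv] := leP v.+1%:R lambda.
    apply: le_trans (stein_segment_dist lambda_gt0 (ltnW vs) sa sb) _.
    by rewrite ler_wpM2r//; exact: stein_segment_step_tail.
  apply: le_trans (dist_from_steps step sa sb) _; rewrite ler_wpM2r//.
  rewrite ler_pdivlMr ?exprn_gt0// expr2 mulKf// (le_trans (ltW lv))//.
  by rewrite expr2 ler_peMl// ler1n.
Qed.
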